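(* Let $\Gamma$ be a compact metric graph, $d\ge0$, and let $T\subseteq\mathrm{Div}^d_{+,\mathbb{R}}(\Gamma)$ be the tropical polytope generated by $D_1,\dots,D_n\in\mathrm{Div}^d_{+,\mathbb{R}}(\Gamma)$. Let $E$ be an $\mathbb{R}$-divisor of degree $d$. Then: (1) $E\in T$ if and only if $\bigcup_{i=1}^n\Gamma_{\min}(f_{D_i-E})=\Gamma$. (2) If $D_0=\pi_T(E)$ and $D$ is an arbitrary $\mathbb{R}$-divisor in $T$, then $\Gamma_{\min}(f_{D-E})\subseteq\Gamma_{\min}(f_{D_0-E})=\bigcup_{i=1}^n\Gamma_{\min}(f_{D_i-E})$. (3) If $S$ is the set of extremals of $T$, then $S\subseteq\{D_1,\dots,D_n\}$ and $T=\mathrm{tconv}(S)$.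
   Context: $\Gamma$ is a compact metric graph with finite edge lengths. An $\mathbb{R}$-divisor is a finitely supported function $D:\Gamma\to\mathbb{R}$, written $\sum_pD(p)\cdot(p)$; its degree is $\sum_pD(p)$; it is effective if $D(p)\ge0$ for all $p$. $\mathrm{Div}^d_{+,\mathbb{R}}(\Gamma)$ is the set of effective $\mathbb{R}$-divisors of degree $d$. For a continuous piecewise-affine function $f$ on $\Gamma$, $\mathrm{div}(f)$ is the $\mathbb{R}$-divisor whose value at $p$ is the sum of the slopes of $f$ along all incoming tangent directions at $p$ (i.e. minus the sum of outgoing slopes). For every degree-0 $\mathbb{R}$-divisor $D$ there is a continuous piecewise-affine $f_D$ with $\mathrm{div}(f_D)=D$, unique up to an additive constant. $\Gamma_{\min}(f)$ is the set of points where $f$ attains its minimum. For $D_1,D_2\in\mathrm{Div}^d_{+,\mathbb{R}}(\Gamma)$ let $f=f_{D_2-D_1}$, $\underline{f}=f-\min f$, $l=\max f-\min f$; the tropical segment is $[D_1,D_2]=\{\mathrm{div}(\min(t,\underline{f}))+D_1:t\in[0,l]\}$. A subset of $\mathrm{Div}^d_{+,\mathbb{R}}(\Gamma)$ is tropically convex if it contains the tropical segment between any two of its elements; $\mathrm{tconv}(S)$ is the intersection of all tropically convex sets containing $S$; a tropical polytope is $\mathrm{tconv}$ of a finite set (it is compact). An extremal of a tropically convex $T$ is $D\in T$ with $D\notin\mathrm{tconv}(T\setminus\{D\})$. For a compact tropically convex $T\subseteq\mathrm{Div}^d_{+,\mathbb{R}}(\Gamma)$ and an $\mathbb{R}$-divisor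 $E$ of degree $d$, the tropical projection $\pi_T(E)$ is the unique element of $T$ minimizing $D\mapsto\int_\Gamma(f_{D-E}-\min f_{D-E})\,d\mu$ over $T$, where $\mu$ is the length (Lebesgue) measure on $\Gamma$. *)

(* Defs.v *)
From HB Require Import structures.
From mathcomp Require Import all_boot all_order all_algebra.
From mathcomp Require Import all_classical all_reals all_analysis.
Set Implicit Arguments.
Unset Strict Implicit.
Unset Printing Implicit Defensive.
Import Order.TTheory GRing.Theory Num.Theory.
Import numFieldNormedType.Exports.
Local Open Scope classical_set_scope.
Local Open Scope ring_scope.

Definition adjacent (V E : finType) (src tgt : E -> V) : rel V :=
  [rel u v | [exists e, ((src e == u) && (tgt e == v))
                     || ((src e == v) && (tgt e == u))]].

(* A compact metric graph is given by a model: a nonempty finite connected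
   multigraph (loops and parallel edges allowed) with positive real edge
   lengths, of which it is the geometric realization. The orientation of the
   edges only serves to parametrize them. Connectedness is implied by the
   existence of a potential for every divisor of degree 0. *)
Record metricGraph (R : realType) := MetricGraph {
  vertex : finType;
  edge : finType;
  src : edge -> vertex;
  tgt : edge -> vertex;
  len : edge -> R;
  len_gt0 : forall e, 0 < len e;
  vertex_gt0 : (0 < #|vertex|)%N;
  graph_connected : forall u v, connect (adjacent src tgt) u v
}.

Section MetricGraph.
Variables (R : realType) (G : metricGraph R).

(* Each point of the realization has exactly one representation: a vertex, or a
   position strictly inside an edge. *)
Inductive gpoint : Type :=
  | Vertex of vertex G
  | Interior (e : edge G) of {t : R | 0 < t < len e}.

HB.instance Definition _ := gen_eqMixin gpoint.
HB.instance Definition _ := gen_choiceMixin gpoint.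

(* The point at distance t from src e along e, for 0 <= t <= len e (other values
   of t are sent to the nearest endpoint). *)
Definition edge_point (e : edge G) (t : R) : gpoint :=
  if insub t is Some u then @Interior e u
  else if t <= 0 then Vertex (src e) else Vertex (tgt e).

Implicit Types (f : gpoint -> R) (D E : gpoint -> R) (d : R).

(* Since the realization carries the quotient topology, continuity on it is
   continuity along every closed edge. *)
Definition continuous_on_graph f :=
  forall e, {within `[0, len e], continuous (f \o edge_point e)}.

(* B lists the finitely many breakpoints on e. *)
Definition piecewise_affine f :=
  forall e, exists B : seq R, forall a b, 0 <= a -> a < b -> b <= len e ->
    (forall t, a < t < b -> t \notin B) ->
    exists m c, forall t, a < t < b -> f (edge_point e t) = m * t + c.

Definition continuous_pa f := continuous_on_graph f /\ piecewise_affine f.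

(* Outgoing slope of f at the point at position t of e, in the direction of
   increasing (s = 1) or decreasing (s = -1) position. *)
Definition out_slope f (e : edge G) (t s : R) : R :=
  lim ((f (edge_point e (t + s * h)) - f (edge_point e t)) / h @[h --> 0^'+]).

(* A loop at v contributes two tangent directions at v. *)
Definition div f : gpoint -> R := fun p =>
  - match p with
    | Vertex v => \sum_(e | src e == v) out_slope f e 0 1
                + \sum_(e | tgt e == v) out_slope f e (len e) (-1)
    | @Interior e u => out_slope f e (val u) 1 + out_slope f e (val u) (-1)
    end.

(* R-divisors are handled as functions, with their pointwise additive structure;
   the finite-support condition is part of the sets below. *)
Definition degree D : R := \sum_(p \in [set: gpoint]) D p.

Definition Div d : set (gpoint -> R) :=
  [set D | finite_set [set p | D p != 0] /\ degree D = d].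

Definition eff_Div d : set (gpoint -> R) :=
  [set D | Div d D /\ forall p, 0 <= D p].

(* f_D is only determined up to an additive constant; all the notions below are
   insensitive to the choice of this constant. *)
Definition potential D : gpoint -> R :=
  xget (fun=> 0) [set f | continuous_pa f /\ div f = D].

(* These are attained when f is continuous, the graph being compact. *)
Definition gmin f : R := inf (range f).
Definition gmax f : R := sup (range f).

Definition argmin f : set gpoint := [set p | forall q, f p <= f q].

Definition underline f : gpoint -> R := fun p => f p - gmin f.

Definition tsegment D1 D2 : set (gpoint -> R) :=
  let f := potential (D2 - D1) in
  [set div (fun p => Num.min t (underline f p)) + D1
     | t in `[0, gmax f - gmin f]].

Definition tropically_convex d (T : set (gpoint -> R)) :=
  T `<=` eff_Div d /\
  forall D1 D2, T D1 -> T D2 -> tsegment D1 D2 `<=` T.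

(* smallest C S is the intersection of all the sets satisfying C that contain
   S. *)
Definition tconv d (S : set (gpoint -> R)) : set (gpoint -> R) :=
  smallest (tropically_convex d) S.

Definition extremals d (T : set (gpoint -> R)) : set (gpoint -> R) :=
  [set D | T D /\ ~ tconv d (T `\ D) D].

(* Integral against the length measure of the graph; the vertices have measure
   zero. *)
Definition graph_integral f : R :=
  \sum_e \int[lebesgue_measure]_(t in `[0, len e]) f (edge_point e t).

Definition proj_functional E D : R :=
  graph_integral (underline (potential (D - E))).

Definition proj_minimizer (T : set (gpoint -> R)) E D0 :=
  T D0 /\ forall D, T D -> proj_functional E D0 <= proj_functional E D.

(* E is a dummy value, for the case where T has no unique minimizer (T empty,
   for instance). *)
Definition tropical_projection (T : set (gpoint -> R)) E : gpoint -> R :=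
  xget E [set D0 | unique (proj_minimizer T E) D0].

End MetricGraph.

(* Main.v *)
From HB Require Import structures.
Require Import Defs.
From mathcomp Require Import all_boot all_order all_algebra.
From mathcomp Require Import all_classical all_reals all_analysis.
From mathcomp Require Import ring lra.
Set Implicit Arguments.
Unset Strict Implicit.
Unset Printing Implicit Defensive.
Import Order.TTheory GRing.Theory Num.Theory.
Import numFieldNormedType.Exports.
Local Open Scope classical_set_scope.
Local Open Scope ring_scope.

(* Fix E and write D = E + div g. Tropical segments then become pointwise minima
   min(g1 + c1, g2 + c2), and the polytope generated by the D_i = E + div f_i is
   the set of all E + div (min_i (f_i + c_i)); effectivity is preserved because
   div (min(f, g)) >= div f wherever f <= g. If h = min_i (f_i - min f_i), then
   E + div h lies in the polytope, h >= 0 vanishes exactly on the union of the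
   Gamma_min(f_i), and h <= g - min g for every E + div g in the polytope. Hence
   E + div h is the projection of E, and E belongs to the polytope iff h = 0. For
   extremals, a generator that is not redundant is extremal, by the covering
   criterion; redundant generators are discarded one at a time. *)

(** * One-sided affine germs on the line *)

(** Why [h <= g - min g]: at each point [p] some [f = f_i + c] touches [g] from above, so
    [min f >= min g] while [f p = g p]; subtracting the minima gives [f_i - min f_i <= g - min g] at
    [p]. The same contact at a minimizer [p] of [g] makes [p] a minimizer of [f_i], whence the
    covering criterion. The dictionary between divisors of degree 0 and functions up to constants
    has to be built: uniqueness by an energy argument, existence by tents that push mass from the
    interior of the edges to the vertices, where the Laplacian is inverted. Slopes are given by a
    total [lim] and piecewise affinity by breakpoint lists, both awkward for sums and minima.
    Everything therefore passes through germs, that is exact affine behaviour on one side of a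
    point: a local notion stable under these operations, from which the breakpoint lists are
    recovered by interval induction. *)

Definition germ (R : realType) (phi : R -> R) (t s m : R) :=
  \forall h \near 0^'+, phi (t + s * h) = phi t + m * h.

Section RealLine.
Variable R : realType.
Implicit Types (phi psi : R -> R) (t s m c : R).

Lemma germ_affine m c t s : germ (fun x => m * x + c) t s (s * m).
Proof. by near=> h; ring. Unshelve. all: by end_near. Qed.

Lemma germD phi psi t s m m' :
  germ phi t s m -> germ psi t s m' -> germ (fun x => phi x + psi x) t s (m + m').
Proof. by apply: filterS2 => h /= -> ->; ring. Qed.

Lemma germZ phi t s m c : germ phi t s m -> germ (fun x => c * phi x) t s (c * m).
Proof. by apply: filterS => h /= ->; ring. Qed.

Lemma germ_lim phi t s m : germ phi t s m ->
  lim ((phi (t + s * h) - phi t) / h @[h --> 0^'+]) = m.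
Proof.
move=> g; apply/cvg_lim => //; apply: cvg_near_cst; near=> h.
have h0 : 0 < h by [].
have -> : phi (t + s * h) = phi t + m * h by near: h.
by field; rewrite gt_eqF.
Unshelve. all: by end_near. Qed.

Lemma near_scale_lt s (e : R) : 0 < e -> \forall h \near (0:R)^'+, `|s * h| < e.
Proof.
move=> e0; near=> h.
have h0 : 0 < h by [].
have : h < e / (`|s| + 1).
  by near: h; apply: nbhs_right_lt; rewrite divr_gt0 // ltr_wpDl.
rewrite ltr_pdivlMr ?ltr_wpDl // normrM (gtr0_norm h0); nra.
Unshelve. all: by end_near. Qed.

Lemma germ_min_lt phi psi t s m m' :
  phi t < psi t -> germ phi t s m -> germ psi t s m' ->
  germ (fun x => Num.min (phi x) (psi x)) t s m.
Proof.
move=> lt_t g g'; near=> h.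
have h0 : 0 < h by [].
have e : phi (t + s * h) = phi t + m * h by near: h.
have e' : psi (t + s * h) = psi t + m' * h by near: h.
have b : `|(m - m') * h| < psi t - phi t.
  by near: h; apply: near_scale_lt; rewrite subr_gt0.
have := ler_norm ((m - m') * h) => b'.
by rewrite e e' (min_l (ltW lt_t)) min_l //; lra.
Unshelve. all: by end_near. Qed.

Lemma germ_min_eq phi psi t s m m' :
  phi t = psi t -> germ phi t s m -> germ psi t s m' ->
  germ (fun x => Num.min (phi x) (psi x)) t s (Num.min m m').
Proof.
move=> e_t g g'; near=> h.
have h0 : 0 < h by [].
have e : phi (t + s * h) = phi t + m * h by near: h.
have e' : psi (t + s * h) = psi t + m' * h by near: h.
rewrite e e' -e_t minxx; case: (leP m m') => mm'.
  by rewrite min_l // lerD2l ler_wpM2r // ltW.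
by rewrite min_r // lerD2l ler_wpM2r // ltW.
Unshelve. all: by end_near. Qed.

(** Source of effectivity: since [div] is minus the sum of the outgoing slopes, a slope lowered by
    taking the minimum can only raise the divisor. *)
Lemma germ_min_le phi psi t s m m' :
  phi t <= psi t -> germ phi t s m -> germ psi t s m' ->
  exists2 m'', m'' <= m & germ (fun x => Num.min (phi x) (psi x)) t s m''.
Proof.
rewrite le_eqVlt => /predU1P[e|lt_t] g g'.
  by exists (Num.min m m'); [rewrite ge_min lexx|exact: germ_min_eq].
by exists m => //; exact: germ_min_lt g'.
Qed.

Lemma near_tangent (a b t s : R) :
  a <= t <= b -> (s = 1 /\ t < b) \/ (s = -1 /\ a < t) ->
  \forall h \near (0:R)^'+, a < t + s * h < b.
Proof.
move=> /andP[t0 tL] [] [-> lt]; near=> h.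
  have h0 : 0 < h by [].
  have : h < b - t by near: h; apply: nbhs_right_lt; rewrite subr_gt0.
  by move=> ?; apply/andP; split; lra.
have h0 : 0 < h by [].
have : h < t - a by near: h; apply: nbhs_right_lt; rewrite subr_gt0.
by move=> ?; apply/andP; split; lra.
Unshelve. all: by end_near. Qed.

Lemma eq_germ (a b : R) phi psi t s m : (forall x, a <= x <= b -> phi x = psi x) ->
  a <= t <= b -> (s = 1 /\ t < b) \/ (s = -1 /\ a < t) ->
  germ phi t s m -> germ psi t s m.
Proof.
move=> e tL st g; near=> h.
have /andP[h0 h1] : a < t + s * h < b by near: h; exact: near_tangent.
rewrite -!e ?tL ?(ltW h0) ?(ltW h1) //.
by near: h.
Unshelve. all: by end_near. Qed.

(* A Cousin-type lemma: take the supremum of the x such that P a x holds. *)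
Lemma interval_induction (P : R -> R -> Prop) (a b : R) : a < b ->
  (forall x y z, a <= x -> x < y -> y < z -> z <= b -> P x y -> P y z -> P x z) ->
  (forall t, a <= t -> t < b -> \forall h \near 0^'+, P t (t + h)) ->
  (forall t, a < t -> t <= b -> \forall h \near 0^'+, P (t - h) t) ->
  P a b.
Proof.
move=> ab Padd Pr Pl.
pose S := [set x | a < x <= b /\ P a x].
have [x0 Sx0] : S !=set0.
  have : \forall h \near 0^'+, S (a + h).
    near=> h; have h0 : 0 < h by [].
    split; last by near: h; exact: Pr.
    have : h < b - a by near: h; apply: nbhs_right_lt; rewrite subr_gt0.
    by move=> ?; apply/andP; split; lra.
  by move=> /filter_ex[h]; exists (a + h).
have hS : has_sup S by split; [exists x0|exists b => x [/andP[]]].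
pose c := sup S.
have ubS x : S x -> x <= c by move=> Sx; exact: ub_le_sup hS.2 _ Sx.
have ac : a < c by apply: lt_le_trans (ubS _ Sx0); case: Sx0 => /andP[].
have cb : c <= b by apply: sup_le_ub; [exists x0|move=> x [/andP[]]].
have Pc : P a c.
  have [/= e e0 He] := Pl _ ac cb.
  have [x Sx xc] := sup_adherent e0 hS.
  have := ubS _ Sx; rewrite le_eqVlt => /predU1P[<-|ltx]; first by case: Sx.
  case: Sx => /andP[ax xb] Pax.
  apply: (Padd a x c) => //.
  have -> : x = c - (c - x) by ring.
  apply: He; last by rewrite /= subr_gt0.
  by rewrite /= sub0r normrN gtr0_norm ?subr_gt0 //; rewrite -/c in xc; lra.
move: cb; rewrite le_eqVlt => /predU1P[<- //|cb].
have cb' : 0 < b - c by rewrite subr_gt0.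
have [h [[/= Ph hb] h0]] := filter_ex
  (filterI (filterI (Pr _ (ltW ac) cb) (nbhs_right_lt cb')) (nbhs_right_gt 0)).
have : S (c + h).
  split; first by apply/andP; split; lra.
  by apply: (Padd a c (c + h)) => //; lra.
by move/ubS; lra.
Unshelve. all: by end_near. Qed.

Lemma germ_itv phi t s m : germ phi t s m ->
  \forall h \near 0^'+, forall x, 0 <= x <= h -> phi (t + s * x) = phi t + m * x.
Proof.
move=> [/= e e0 He]; exists e => // h /=; rewrite sub0r normrN => he h0 x /andP[x0 xh].
have [->|xn0] := eqVneq x 0; first by rewrite !mulr0 !addr0.
apply: He; rewrite /= ?lt_def ?xn0 //.
by rewrite sub0r normrN (ger0_norm x0); rewrite gtr0_norm // in he; lra.
Qed.

Lemma germ_right_cvg phi t m : germ phi t 1 m -> phi x @[x --> t^'+] --> phi t.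
Proof.
move=> [/= e e0 He].
have : (fun x => phi t + m * (x - t)) x @[x --> t^'+] --> phi t + m * (t - t).
  apply: cvg_within_filter; apply: cvgD; first exact: cvg_cst.
  by apply: cvgMr; apply: cvgB; [exact: cvg_id|exact: cvg_cst].
rewrite subrr mulr0 addr0; apply: cvg_trans; apply: near_eq_cvg.
exists e => //= x xe tx; rewrite -He /= ?subr_gt0 //; first by congr phi; ring.
by rewrite sub0r normrN distrC.
Qed.

Lemma germ_left_cvg phi t m : germ phi t (-1) m -> phi x @[x --> t^'-] --> phi t.
Proof.
move=> [/= e e0 He].
have : (fun x => phi t + m * (t - x)) x @[x --> t^'-] --> phi t + m * (t - t).
  apply: cvg_within_filter; apply: cvgD; first exact: cvg_cst.
  by apply: cvgMr; apply: cvgB; [exact: cvg_cst|exact: cvg_id].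
rewrite subrr mulr0 addr0; apply: cvg_trans; apply: near_eq_cvg.
exists e => //= x xe tx; rewrite -He /= ?subr_gt0 //; first by congr phi; ring.
by rewrite sub0r normrN.
Qed.

(** These are the tangent directions of a closed edge of length [L]: both at an inner position, only
    the inward one at an end. *)
Definition tangent (L t s : R) := 0 <= t <= L /\ ((s = 1 /\ t < L) \/ (s = -1 /\ 0 < t)).

Lemma tangent_right (L t : R) : 0 <= t -> t < L -> tangent L t 1.
Proof. by move=> t0 tL; split; [rewrite t0 ltW|left]. Qed.

Lemma tangent_left (L t : R) : 0 < t -> t <= L -> tangent L t (-1).
Proof. by move=> t0 tL; split; [rewrite tL ltW|right]. Qed.

Lemma germs_continuous (L : R) phi : 0 < L ->
  (forall t s, tangent L t s -> exists m, germ phi t s m) ->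
  {within `[0, L], continuous phi}.
Proof.
move=> L0 g; apply/continuous_within_itvP => //; split.
- move=> x; rewrite in_itv /= => /andP[x0 xL]; apply/left_right_continuousP.
  have [m gm] := g _ _ (tangent_left x0 (ltW xL)).
  have [m' gm'] := g _ _ (tangent_right (ltW x0) xL).
  by split; [exact: germ_left_cvg gm|exact: germ_right_cvg gm'].
- have [m gm] := g _ _ (tangent_right (lexx 0) L0); exact: germ_right_cvg gm.
- have [m gm] := g _ _ (tangent_left L0 (lexx L)); exact: germ_left_cvg gm.
Qed.

(** Beside each point a germ is affine on a whole interval, so the empty list works there; gluing
    two intervals adds only their common end to the breakpoints. *)
Lemma germs_affine (L : R) phi : 0 < L ->
  (forall t s, tangent L t s -> exists m, germ phi t s m) ->
  exists B : seq R, forall a b, 0 <= a -> a < b -> b <= L ->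
    (forall t, a < t < b -> t \notin B) ->
    exists m c, forall t, a < t < b -> phi t = m * t + c.
Proof.
move=> L0 g.
apply: (interval_induction (P := fun x y => exists B : seq R,
  forall a b, x <= a -> a < b -> b <= y -> (forall t, a < t < b -> t \notin B) ->
    exists m c, forall t, a < t < b -> phi t = m * t + c)) => //.
- move=> x y z x0 xy yz zL [B1 H1] [B2 H2]; exists (y :: B1 ++ B2) => a b xa ab bz H.
  have [yb|yb] := ltP y b; last first.
    apply: H1 => // t tab; have := H _ tab; rewrite inE mem_cat.
    by apply: contra => ->; rewrite orbT.
  have [ya|ya] := leP y a; last by have := H y; rewrite ya yb => /(_ isT); rewrite inE eqxx.
  apply: H2 => // t tab; have := H _ tab; rewrite inE mem_cat.
  by apply: contra => ->; rewrite !orbT.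
- move=> t t0 tL; have [m /germ_itv gm] := g _ _ (tangent_right t0 tL).
  near=> h; exists [::] => a b ta ab bt _; exists m, (phi t - m * t) => x /andP[ax xb].
  have H : forall x, 0 <= x <= h -> phi (t + 1 * x) = phi t + m * x by near: h.
  have -> : x = t + 1 * (x - t) by ring.
  by rewrite H; [ring|lra].
- move=> t t0 tL; have [m /germ_itv gm] := g _ _ (tangent_left t0 tL).
  near=> h; exists [::] => a b ta ab bt _; exists (- m), (phi t + m * t) => x /andP[ax xb].
  have H : forall x, 0 <= x <= h -> phi (t + (-1) * x) = phi t + m * x by near: h.
  have -> : x = t + (-1) * (t - x) by ring.
  by rewrite H; [ring|lra].
Unshelve. all: by end_near. Qed.

Lemma next_breakpoint (B : seq R) (t L : R) : t < L ->
  exists u, [/\ t < u, u <= L & forall x, t < x < u -> x \notin B].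
Proof.
move=> tL; elim: B => [|b B [u [tu uL H]]]; first by exists L.
have [tb|bt] := ltP t b; last first.
  exists u; split=> // x /andP[tx xu]; rewrite inE negb_or H ?tx // andbT.
  by rewrite gt_eqF // (le_lt_trans bt).
exists (Num.min u b); rewrite lt_min tu tb ge_min uL; split=> // x.
rewrite lt_min => /and3P[tx xu xb]; rewrite inE negb_or lt_eqF //= H //.
by rewrite tx.
Qed.

Lemma prev_breakpoint (B : seq R) (t L : R) : L < t ->
  exists u, [/\ u < t, L <= u & forall x, u < x < t -> x \notin B].
Proof.
move=> tL; have [|u [tu uL H]] := @next_breakpoint (map -%R B) (- t) (- L).
  by rewrite ltrN2.
exists (- u); split; [lra|lra|move=> x xut].
have /H : - t < - x < u by lra.
by apply: contra => ?; apply: map_f.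
Qed.

Lemma continuous_affine_germs (L : R) phi : 0 < L ->
  {within `[0, L], continuous phi} ->
  (exists B : seq R, forall a b, 0 <= a -> a < b -> b <= L ->
    (forall t, a < t < b -> t \notin B) ->
    exists m c, forall t, a < t < b -> phi t = m * t + c) ->
  forall t s, tangent L t s -> exists m, germ phi t s m.
Proof.
move=> L0 /(continuous_within_itvP _ L0)[ci c0 cL] [B HB] t s [/andP[t0 tL] []] [-> lt].
- have [u [tu uL /(HB _ _ t0 tu uL)[m [c H]]]] := next_breakpoint B lt.
  have cr : phi x @[x --> t^'+] --> phi t.
    move: t0; rewrite le_eqVlt => /predU1P[<- //|t0].
    have /ci/left_right_continuousP[//] : t \in `]0, L[ by rewrite in_itv /= t0.
  (* [H] holds only strictly between breakpoints; continuity extends the affine formula to the end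
     [t]. *)
  have e : phi t = m * t + c.
    apply: (cvg_unique _ cr) => //.
    have : (fun x => m * x + c) x @[x --> t^'+] --> m * t + c.
      apply: cvg_within_filter; apply: cvgD; last exact: cvg_cst.
      by apply: cvgMr; exact: cvg_id.
    apply: cvg_trans; apply: near_eq_cvg; near=> x.
    rewrite H //; apply/andP; split; near: x; [exact: nbhs_right_gt|exact: nbhs_right_lt].
  exists m; near=> h; have h0 : 0 < h by [].
  rewrite H ?e; first by ring.
  have : h < u - t by near: h; apply: nbhs_right_lt; rewrite subr_gt0.
  lra.
- have [u [tu uL H0]] := prev_breakpoint B lt.
  have [m [c H]] := HB _ _ uL tu tL H0.
  have cr : phi x @[x --> t^'-] --> phi t.
    move: tL; rewrite le_eqVlt => /predU1P[-> //|tL].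
    have /ci/left_right_continuousP[//] : t \in `]0, L[ by rewrite in_itv /= lt.
  have e : phi t = m * t + c.
    apply: (cvg_unique _ cr) => //.
    have : (fun x => m * x + c) x @[x --> t^'-] --> m * t + c.
      apply: cvg_within_filter; apply: cvgD; last exact: cvg_cst.
      by apply: cvgMr; exact: cvg_id.
    apply: cvg_trans; apply: near_eq_cvg; near=> x.
    rewrite H //; apply/andP; split; near: x; [exact: nbhs_left_gt|exact: nbhs_left_lt].
  exists (- m); near=> h; have h0 : 0 < h by [].
  rewrite H ?e; first by ring.
  have : h < t - u by near: h; apply: nbhs_right_lt; rewrite subr_gt0.
  lra.
Unshelve. all: by end_near. Qed.

(** For [u] in [[0, l]], moving [t] to the nearest point of [[0, l]] changes the minimum by a
    constant independent of [u]. Hence any shift is equivalent, up to constants, to an admissible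
    parameter of a tropical segment. *)
Lemma min_clamp (t l u : R) : 0 <= u -> u <= l ->
  Num.min t u = Num.min (Num.max 0 (Num.min t l)) u + Num.min t 0.
Proof.
move=> u0 ul; have [t0|t0] := leP t 0.
  by rewrite (@min_l _ _ t l) ?max_l ?(@min_l _ _ t u) ?min_l //; lra.
rewrite addr0; have [tl|tl] := leP t l; first by rewrite max_r ?ltW.
by rewrite max_r ?min_r //; lra.
Qed.

End RealLine.

(** * Piecewise affine functions and their divisors *)

Section Graph.
Variables (R : realType) (G : metricGraph R).
Implicit Types (f g : gpoint G -> R) (e : edge G) (t s m c : R) (p : gpoint G).

(** Local form of [continuous_pa], with no breakpoint lists to merge when functions are added or
    minimized. *)
Definition has_germs f := forall e t s, tangent (len e) t s ->
  exists m, germ (f \o edge_point e) t s m.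

Lemma cpaP f : continuous_pa f <-> has_germs f.
Proof.
split=> [[cf af] e|gf]; first exact: continuous_affine_germs (len_gt0 e) (cf e) (af e).
by split=> e; [exact: germs_continuous (len_gt0 e) (gf e)|
               exact: germs_affine (len_gt0 e) (gf e)].
Qed.

Lemma out_slopeE f e t s m : germ (f \o edge_point e) t s m -> out_slope f e t s = m.
Proof. exact: germ_lim. Qed.

Lemma out_slopeP f e t s : continuous_pa f -> tangent (len e) t s ->
  germ (f \o edge_point e) t s (out_slope f e t s).
Proof.
by move=> /cpaP gf te; have [m gm] := gf _ _ _ te; rewrite (out_slopeE gm).
Qed.

Lemma edge_point0 e : edge_point e 0 = Vertex (src e).
Proof. by rewrite /edge_point insubF ?lexx // ltxx. Qed.

Lemma edge_pointL e : edge_point e (len e) = Vertex (tgt e).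
Proof.
rewrite /edge_point insubF ?ltxx ?andbF // ifF //.
by apply/negbTE; rewrite -ltNge len_gt0.
Qed.

Lemma edge_point_interior e (u : {t : R | 0 < t < len e}) :
  edge_point e (val u) = Interior u.
Proof. by rewrite /edge_point valK. Qed.

Lemma gpoint_cases p : (exists v, p = Vertex v) \/
  (exists e t, 0 < t < len e /\ p = edge_point e t).
Proof.
case: p => [v|e u]; first by left; exists v.
by right; exists e, (val u); rewrite edge_point_interior; split => //; exact: (svalP u).
Qed.

Lemma div_vertex f v : div f (Vertex v) =
  - (\sum_(e | src e == v) out_slope f e 0 1 +
     \sum_(e | tgt e == v) out_slope f e (len e) (-1)).
Proof. by []. Qed.

Lemma div_edge_point f e t : 0 < t < len e ->
  div f (edge_point e t) = - (out_slope f e t 1 + out_slope f e t (-1)).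
Proof. by move=> te; rewrite /edge_point insubT. Qed.

Lemma tangent_src e : tangent (len e) 0 1.
Proof. exact: tangent_right (lexx 0) (len_gt0 e). Qed.

Lemma tangent_tgt e : tangent (len e) (len e) (-1).
Proof. exact: tangent_left (len_gt0 e) (lexx _). Qed.

Lemma div_le f g p :
  (forall e t s, tangent (len e) t s -> edge_point e t = p ->
     out_slope f e t s <= out_slope g e t s) ->
  div g p <= div f p.
Proof.
have [[v ->]|[e [t [te ->]]]] := gpoint_cases p => H.
  rewrite !div_vertex lerN2; apply: lerD; apply: ler_sum => e /eqP ev.
    by apply: H; [exact: tangent_src|rewrite edge_point0 ev].
  by apply: H; [exact: tangent_tgt|rewrite edge_pointL ev].
have /andP[t0 tL] := te.
rewrite !div_edge_point // lerN2; apply: lerD; apply: H => //.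
  by apply: tangent_right => //; exact: ltW.
by apply: tangent_left => //; exact: ltW.
Qed.

Lemma eq_div f g p :
  (forall e t s, tangent (len e) t s -> edge_point e t = p ->
     out_slope f e t s = out_slope g e t s) ->
  div g p = div f p.
Proof.
by move=> H; apply/le_anti/andP; split; apply: div_le => e t s te ep; rewrite H.
Qed.

Lemma cpaD f g : continuous_pa f -> continuous_pa g -> continuous_pa (f + g).
Proof.
move=> /cpaP gf /cpaP gg; apply/cpaP => e t s te.
by have [m gm] := gf _ _ _ te; have [m' gm'] := gg _ _ _ te; exists (m + m'); exact: germD.
Qed.

Lemma cpaZ c f : continuous_pa f -> continuous_pa (fun p => c * f p).
Proof.
move=> /cpaP gf; apply/cpaP => e t s te.
by have [m gm] := gf _ _ _ te; exists (c * m); exact: germZ.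
Qed.

Lemma germ_cst c e t s : germ ((cst c : gpoint G -> R) \o edge_point e) t s 0.
Proof. by near=> h; rewrite mul0r addr0. Unshelve. all: by end_near. Qed.

Lemma cpa_cst c : continuous_pa (cst c : gpoint G -> R).
Proof. by apply/cpaP => e t s te; exists 0; exact: germ_cst. Qed.

Lemma cpaB f g : continuous_pa f -> continuous_pa g -> continuous_pa (f - g).
Proof.
move=> cf cg.
have -> : f - g = f + (fun p => (-1) * g p) by apply/funext => p; rewrite !fctE mulN1r.
by apply: cpaD => //; exact: cpaZ.
Qed.

Lemma cpa_min f g : continuous_pa f -> continuous_pa g -> continuous_pa (f \min g).
Proof.
move=> /cpaP gf /cpaP gg; apply/cpaP => e t s te.
have [m gm] := gf _ _ _ te; have [m' gm'] := gg _ _ _ te.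
case/orP: (le_total (f (edge_point e t)) (g (edge_point e t))) => fg.
  by have [m'' _ gm''] := germ_min_le fg gm gm'; exists m''.
have [m'' _ gm''] := germ_min_le fg gm' gm; exists m''.
by move: gm''; apply: filterS => h /=; rewrite minC [in X in _ = X -> _]minC.
Qed.

Lemma divD f g : continuous_pa f -> continuous_pa g -> div (f + g) = div f + div g.
Proof.
move=> cf cg.
have sD e t s : tangent (len e) t s ->
    out_slope (f + g) e t s = out_slope f e t s + out_slope g e t s.
  by move=> te; apply: out_slopeE; apply: germD; exact: out_slopeP.
apply/funext => p; change (div (f + g) p = div f p + div g p).
have [[v ->]|[e [t [te ->]]]] := gpoint_cases p.
  rewrite !div_vertex -opprD addrACA -!big_split /=; congr (- (_ + _)).
    by apply: eq_bigr => e _; apply: sD; exact: tangent_src.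
  by apply: eq_bigr => e _; apply: sD; exact: tangent_tgt.
have /andP[t0 tL] := te.
rewrite !div_edge_point // !sD; first by rewrite -opprD addrACA.
  by apply: tangent_left => //; exact: ltW.
by apply: tangent_right => //; exact: ltW.
Qed.

Lemma divZ c f : continuous_pa f -> div (fun p => c * f p) = fun p => c * div f p.
Proof.
move=> cf.
have sZ e t s : tangent (len e) t s ->
    out_slope (fun p => c * f p) e t s = c * out_slope f e t s.
  by move=> te; apply: out_slopeE; apply: germZ; exact: out_slopeP.
apply/funext => p.
have [[v ->]|[e [t [te ->]]]] := gpoint_cases p.
  rewrite !div_vertex mulrN mulrDr !mulr_sumr; congr (- (_ + _)).
    by apply: eq_bigr => e _; apply: sZ; exact: tangent_src.
  by apply: eq_bigr => e _; apply: sZ; exact: tangent_tgt.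
have /andP[t0 tL] := te.
rewrite !div_edge_point // !sZ; first by ring.
  by apply: tangent_left => //; exact: ltW.
by apply: tangent_right => //; exact: ltW.
Qed.

Lemma divB f g : continuous_pa f -> continuous_pa g -> div (f - g) = div f - div g.
Proof.
move=> cf cg.
have -> : f - g = f + (fun p => (-1) * g p) by apply/funext => p; rewrite !fctE mulN1r.
rewrite divD //; last exact: cpaZ.
by rewrite divZ //; apply/funext => p; rewrite !fctE mulN1r.
Qed.

Lemma div_cst c : div (cst c : gpoint G -> R) = 0.
Proof.
have s0 e t s : out_slope (cst c : gpoint G -> R) e t s = 0.
  by apply: out_slopeE; exact: germ_cst.
apply/funext => p.
have [[v ->]|[e [t [te ->]]]] := gpoint_cases p.
  by rewrite div_vertex !big1 ?addr0 ?oppr0 // => e _; rewrite s0.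
by rewrite div_edge_point // !s0 addr0 oppr0.
Qed.

Lemma div_min_ge f g p : continuous_pa f -> continuous_pa g -> f p <= g p ->
  div f p <= div (f \min g) p.
Proof.
move=> cf cg fg; apply: div_le => e t s te ep; rewrite -ep in fg.
have [m'' le gm''] := germ_min_le fg (out_slopeP cf te) (out_slopeP cg te).
by rewrite (out_slopeE (f := f \min g) gm'').
Qed.

End Graph.

(** * Principal divisors have degree 0, and a zero divisor forces a constant function *)

Section Degree.
Variables (R : realType) (G : metricGraph R).
Implicit Types (f g : gpoint G -> R) (e : edge G) (t s m c : R) (p : gpoint G).

Lemma affine_out_slope f e (a b k c x s : R) :
  (forall y, a <= y <= b -> f (edge_point e y) = k * y + c) ->
  a <= x <= b -> (s = 1 /\ x < b) \/ (s = -1 /\ a < x) ->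
  out_slope f e x s = s * k.
Proof.
move=> H xab sx; apply: out_slopeE.
by apply: eq_germ xab sx (germ_affine k c x s) => y /H.
Qed.

Lemma affine_right f e t : continuous_pa f -> 0 <= t -> t < len e ->
  \forall h \near 0^'+, exists k c,
    forall y, t <= y <= t + h -> f (edge_point e y) = k * y + c.
Proof.
move=> cf t0 tL; have /germ_itv := out_slopeP cf (tangent_right t0 tL).
set k := out_slope _ _ _ _; apply: filterS => h H.
exists k, (f (edge_point e t) - k * t) => y /andP[ty yh].
have -> : y = t + 1 * (y - t) by ring.
by have /= -> := H (y - t) _; [ring|lra].
Qed.

Lemma affine_left f e t : continuous_pa f -> 0 < t -> t <= len e ->
  \forall h \near 0^'+, exists k c,
    forall y, t - h <= y <= t -> f (edge_point e y) = k * y + c.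
Proof.
move=> cf t0 tL; have /germ_itv := out_slopeP cf (tangent_left t0 tL).
set k := out_slope _ _ _ _; apply: filterS => h H.
exists (- k), (f (edge_point e t) + k * t) => y /andP[ty yh].
have -> : y = t + (-1) * (t - y) by ring.
by have /= -> := H (t - y) _; [ring|lra].
Qed.

Definition bend f e t := out_slope f e t 1 + out_slope f e t (-1).

(** A telescoping sum: on an affine piece the inward slopes at the two ends cancel, and where two
    pieces are glued, the two slopes at the junction make up its bend. *)
Lemma sum_bends f e : continuous_pa f -> exists s : seq R,
  [/\ uniq s, forall t, t \in s -> 0 < t < len e,
      forall t, 0 < t < len e -> t \notin s -> bend f e t = 0 &
      \sum_(t <- s) bend f e t + out_slope f e 0 1 + out_slope f e (len e) (-1) = 0].
Proof.
move=> cf.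
apply: (interval_induction (P := fun x y => exists s : seq R,
  [/\ uniq s, forall t, t \in s -> x < t < y,
      forall t, x < t < y -> t \notin s -> bend f e t = 0 &
      \sum_(t <- s) bend f e t + out_slope f e x 1 + out_slope f e y (-1) = 0])).
- exact: len_gt0.
- move=> x y z x0 xy yz zL [s1 [u1 i1 b1 S1]] [s2 [u2 i2 b2 S2]].
  exists (s1 ++ y :: s2); split.
  + rewrite cat_uniq u1 cons_uniq u2 andbT /=; apply/andP; split.
      rewrite negb_or; apply/andP; split; first by apply/negP => /i1; lra.
      by apply/hasPn => t /i2 ht; apply/negP => /i1; lra.
    by apply/negP => /i2; lra.
  + by move=> t; rewrite mem_cat inE => /or3P[/i1|/eqP ->|/i2]; lra.
  + move=> t /andP[xt tz]; rewrite mem_cat inE !negb_or => /and3P[n1 ty n2].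
    have [lty|lyt|e1] := ltgtP t y; [|by apply: b2 => //; rewrite lyt|by rewrite e1 eqxx in ty].
    by apply: b1 => //; rewrite xt.
  + rewrite big_cat big_cons /= {2}/bend; move: S1 S2; lra.
- move=> t t0 tL; near=> h; have h0 : 0 < h by [].
  have [k [c H]] : exists k c, forall y, t <= y <= t + h -> f (edge_point e y) = k * y + c.
    by near: h; exact: affine_right.
  exists [::]; split => // [y yt _|].
    rewrite /bend !(affine_out_slope H); [ring|lra|by right; split; lra|lra|by left; split; lra].
  rewrite big_nil add0r !(affine_out_slope H); [ring|lra|by right; split; lra|lra|by left; split; lra].
- move=> t t0 tL; near=> h; have h0 : 0 < h by [].
  have [k [c H]] : exists k c, forall y, t - h <= y <= t -> f (edge_point e y) = k * y + c.
    by near: h; exact: affine_left.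
  exists [::]; split => // [y yt _|].
    rewrite /bend !(affine_out_slope H); [ring|lra|by right; split; lra|lra|by left; split; lra].
  rewrite big_nil add0r !(affine_out_slope H); [ring|lra|by right; split; lra|lra|by left; split; lra].
Unshelve. all: by end_near. Qed.

(** When two affine pieces meet, a zero divisor at the junction equates their slopes, and the common
    value there equates their constants. *)
Lemma edge_affine f e : continuous_pa f ->
  (forall t, 0 < t < len e -> div f (edge_point e t) = 0) ->
  exists k, exists c, forall y, 0 <= y <= len e -> f (edge_point e y) = k * y + c.
Proof.
move=> cf df.
apply: (interval_induction (P := fun x z => exists k, exists c, forall y, x <= y <= z ->
  f (edge_point e y) = k * y + c)).
- exact: len_gt0.
- move=> x y z x0 xy yz zL [k1 [c1 H1]] [k2 [c2 H2]].
  have : div f (edge_point e y) = 0 by apply: df; lra.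
  rewrite div_edge_point; last by lra.
  rewrite (affine_out_slope H2); [|lra|by left].
  rewrite (affine_out_slope H1); [|lra|by right].
  move=> k12; have e1 : f (edge_point e y) = k1 * y + c1 by apply: H1; lra.
  have e2 : f (edge_point e y) = k2 * y + c2 by apply: H2; lra.
  have ek : k2 = k1 by lra.
  exists k1, c1 => w xwz; have [wy|yw] := leP w y; first by apply: H1; lra.
  rewrite H2; last by lra.
  by rewrite ek in e2 *; lra.
- by move=> t; exact: affine_right.
- by move=> t; exact: affine_left.
Qed.

Lemma edge_point_inj e e' t t' : 0 < t < len e -> 0 < t' < len e' ->
  edge_point e t = edge_point e' t' -> e = e' /\ t = t'.
Proof.
move=> te te'; rewrite /edge_point !insubT /= => E.
pose k (p : gpoint G) := if p is @Interior _ _ a u then Some (a, val u) else None.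
by have /= [] : k (Interior (exist _ t te)) = k (Interior (exist _ t' te')) by rewrite E.
Qed.

(** Sorted by edges, the vertex terms contribute the two end slopes of each edge, which [sum_bends]
    cancels against the bends inside it. The explicit list yields finite support and degree 0
    together. *)
Lemma div_sum f : continuous_pa f -> exists s : seq (gpoint G),
  [/\ uniq s, forall p, p \notin s -> div f p = 0 & \sum_(p <- s) div f p = 0].
Proof.
move=> cf; have /choice[S HS] := fun e => sum_bends e cf.
exists ([seq Vertex v | v <- enum (vertex G)] ++
        [seq edge_point e t | e <- enum (edge G), t <- S e]); split.
- rewrite cat_uniq; apply/and3P; split.
  + by rewrite map_inj_uniq ?enum_uniq // => u v [].
  + apply/hasPn => p /allpairsPdep[e [t [_ tS ->]]].
    have [_ /(_ _ tS) te _ _] := HS e.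
    by apply/negP => /mapP[v _]; rewrite /edge_point insubT.
  + apply: allpairs_uniq_dep; first exact: enum_uniq.
      by move=> e _; have [] := HS e.
    move=> [e t] [e' t'] /allpairsPdep[e1 [t1 [_ tS [-> ->]]]].
    move=> /allpairsPdep[e2 [t2 [_ tS' [-> ->]]]] /= E.
    have [_ /(_ _ tS) te _ _] := HS e1; have [_ /(_ _ tS') te' _ _] := HS e2.
    by have [-> ->] := edge_point_inj te te' E.
- move=> p; rewrite mem_cat negb_or => /andP[].
  have [[v ->]|[e [t [te ->]]]] := gpoint_cases p.
    by rewrite map_f // mem_enum.
  move=> _ nt; have [_ _ H _] := HS e; rewrite div_edge_point // -/(bend f e t).
  rewrite H ?oppr0 //; apply: contra nt => tS.
  by apply/allpairsPdep; exists e, t; rewrite mem_enum.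
- rewrite big_cat big_map big_allpairs_dep /= !big_enum /=.
  under eq_bigr do rewrite div_vertex opprD.
  rewrite big_split /= !sumrN.
  rewrite (exchange_big_dep predT) //= [in X in _ + X + _](exchange_big_dep predT) //=.
  have -> : \sum_e \sum_(v | src e == v) out_slope f e 0 1 = \sum_e out_slope f e 0 1.
    by apply: eq_bigr => e _; rewrite (eq_bigl (pred1 (src e))) ?big_pred1_eq // => v; rewrite /= eq_sym.
  have -> : \sum_e \sum_(v | tgt e == v) out_slope f e (len e) (-1) =
            \sum_e out_slope f e (len e) (-1).
    by apply: eq_bigr => e _; rewrite (eq_bigl (pred1 (tgt e))) ?big_pred1_eq // => v; rewrite /= eq_sym.
  rewrite -!sumrN -!big_split /=; apply: big1 => e _.
  have [_ tS _ H] := HS e.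
  have -> : \sum_(t <- S e) div f (edge_point e t) = - \sum_(t <- S e) bend f e t.
    rewrite -sumrN big_seq [RHS]big_seq; apply: eq_bigr => t /tS te.
    by rewrite div_edge_point.
  by move: H; lra.
Qed.

Lemma degreeE (D : gpoint G -> R) (s : seq (gpoint G)) : uniq s ->
  (forall p, p \notin s -> D p = 0) -> degree D = \sum_(p <- s) D p.
Proof.
move=> us Ds; rewrite /degree (fsbigE s) //; last by move=> p _ /Ds.
by apply: eq_bigl => p; rewrite in_setT.
Qed.

Lemma finite_suppP (D : gpoint G -> R) : finite_set [set p | D p != 0] <->
  exists2 s : seq (gpoint G), uniq s & forall p, p \notin s -> D p = 0.
Proof.
split=> [/finite_seqP[s es]|[s us H]].
  exists (undup s); first exact: undup_uniq.
  move=> p; rewrite mem_undup => ps; apply/eqP; apply: contraT => Dp.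
  have : [set p | D p != 0] p by [].
  by rewrite es /= (negbTE ps).
apply: (@sub_finite_set _ _ [set` s]); last exact: finite_seq.
by move=> p /=; apply: contraNT => /H ->.
Qed.

Lemma DivD d d' (D D' : gpoint G -> R) : Div d D -> Div d' D' -> Div (d + d') (D + D').
Proof.
move=> [/finite_suppP[s us Hs] dD] [/finite_suppP[s' us' Hs'] dD'].
pose r := undup (s ++ s').
have ur : uniq r by exact: undup_uniq.
have Hr p : p \notin r -> D p = 0 /\ D' p = 0.
  by rewrite mem_undup mem_cat negb_or => /andP[/Hs ? /Hs' ?].
have H p : p \notin r -> (D + D') p = 0.
  by move=> /Hr[D0 D'0]; change (D p + D' p = 0); rewrite D0 D'0 addr0.
split; first by apply/finite_suppP; exists r.
rewrite -dD -dD' !(degreeE ur) -?big_split //; move=> p /Hr[] //.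
Qed.

Lemma DivZ d c (D : gpoint G -> R) : Div d D -> Div (c * d) (fun p => c * D p).
Proof.
move=> [/finite_suppP[s us Hs] <-].
have H p : p \notin s -> c * D p = 0 by move=> /Hs ->; rewrite mulr0.
split; first by apply/finite_suppP; exists s.
by rewrite !(degreeE us) ?mulr_sumr.
Qed.

Lemma DivB d d' (D D' : gpoint G -> R) : Div d D -> Div d' D' -> Div (d - d') (D - D').
Proof.
move=> hD /(DivZ (-1)) /(DivD hD); rewrite mulN1r.
suff -> : D + (fun p => -1 * D' p) = D - D' by [].
by apply/funext => p; rewrite !fctE mulN1r.
Qed.

Lemma Div_div f : continuous_pa f -> Div 0 (div f).
Proof.
move=> /div_sum[s [us Hs S0]]; split; first by apply/finite_suppP; exists s.
by rewrite (degreeE us).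
Qed.

(** Summation by parts: a sum over vertices is rearranged into one over edges, each edge giving one
    term at either end. *)
Lemma vertex_energy f : (\sum_v f (Vertex v) * div f (Vertex v)) =
  - \sum_e (f (Vertex (src e)) * out_slope f e 0 1 +
            f (Vertex (tgt e)) * out_slope f e (len e) (-1)).
Proof.
under eq_bigr do rewrite div_vertex mulrN mulrDr !mulr_sumr.
rewrite sumrN big_split /= (exchange_big_dep predT) //=.
rewrite [in X in - (_ + X)](exchange_big_dep predT) //= -big_split /=.
congr (- _); apply: eq_bigr => e _; congr (_ + _).
  by rewrite (eq_bigl (pred1 (src e))) ?big_pred1_eq // => v; rewrite /= eq_sym.
by rewrite (eq_bigl (pred1 (tgt e))) ?big_pred1_eq // => v; rewrite /= eq_sym.
Qed.

Lemma connected_const (A : Type) (h : vertex G -> A) :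
  (forall e, h (src e) = h (tgt e)) -> forall u v, h u = h v.
Proof.
move=> H u v; have /connectP[p pth ->] := graph_connected u v.
elim: p u pth => //= w p IH u /andP[/existsP[e uw] /IH <-].
by case/orP: uw => /andP[/eqP <- /eqP <-].
Qed.

(* The Dirichlet energy \sum_e len e * slope^2 of f is \sum_v f v * div f v. *)
Lemma div0_const f : continuous_pa f -> div f = 0 -> forall p q, f p = f q.
Proof.
move=> cf df.
have /choice[K HK] : forall e, exists kc : R * R, forall y, 0 <= y <= len e ->
    f (edge_point e y) = kc.1 * y + kc.2.
  move=> e; have [|k [c H]] := @edge_affine f e cf; first by move=> t _; rewrite df.
  by exists (k, c).
have fs e : f (Vertex (src e)) = (K e).2.
  by rewrite -edge_point0 HK ?lexx ?(ltW (len_gt0 e)) // mulr0 add0r.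
have ft e : f (Vertex (tgt e)) = (K e).1 * len e + (K e).2.
  by rewrite -edge_pointL HK ?lexx ?(ltW (len_gt0 e)).
have /esym : (0 : R) = \sum_e len e * (K e).1 ^+ 2.
  transitivity (\sum_v f (Vertex v) * div f (Vertex v)).
    by rewrite df big1 // => v _; rewrite mulr0.
  rewrite vertex_energy -sumrN; apply: eq_bigr => e _.
  have L0 := len_gt0 e.
  rewrite !(affine_out_slope (HK e)); [|lra|by right|lra|by left].
  by rewrite fs ft; ring.
move/eqP; rewrite psumr_eq0 => [/allP K0|e _]; last first.
  by rewrite mulr_ge0 ?sqr_ge0 // ltW // len_gt0.
have {}K0 e : (K e).1 = 0.
  have := K0 e; rewrite mem_index_enum => /(_ isT) /=.
  by rewrite mulf_eq0 gt_eqF ?len_gt0 //= sqrf_eq0 => /eqP.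
have fv u v : f (Vertex u) = f (Vertex v).
  by apply: (connected_const (h := fun v => f (Vertex v))) => e; rewrite fs ft K0 mul0r add0r.
have fvp p : exists v, f p = f (Vertex v).
  have [[v ->]|[e [t [te ->]]]] := gpoint_cases p; first by exists v.
  by exists (src e); rewrite fs HK ?K0 ?mul0r ?add0r //; lra.
move=> p q; have [u ->] := fvp p; have [v ->] := fvp q; exact: fv.
Qed.

End Degree.

(** * Existence of potentials *)

Section Existence.
Variables (R : realType) (G : metricGraph R).
Implicit Types (f g : gpoint G -> R) (e : edge G) (t s m c : R) (p : gpoint G).

Definition edgewise (x : vertex G -> R) (phi : edge G -> R -> R) (p : gpoint G) : R :=
  match p with Vertex v => x v | Interior e u => phi e (val u) end.

Lemma edgewiseE x phi e t : phi e 0 = x (src e) -> phi e (len e) = x (tgt e) ->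
  0 <= t <= len e -> edgewise x phi (edge_point e t) = phi e t.
Proof.
move=> e0 eL /andP[]; rewrite le_eqVlt => /predU1P[<- _|t0].
  by rewrite edge_point0 /= e0.
rewrite le_eqVlt => /predU1P[->|tL]; first by rewrite edge_pointL /= eL.
have te : 0 < t < len e by rewrite t0.
by rewrite /edge_point insubT.
Qed.

(** The divisor is left uncontrolled at the vertices, since the Laplacian takes care of any mass
    there. *)
Lemma tent_exists e0 t0 : 0 < t0 < len e0 -> exists f,
  [/\ continuous_pa f, div f (edge_point e0 t0) = 1 &
      forall e t, 0 < t < len e -> edge_point e t <> edge_point e0 t0 ->
        div f (edge_point e t) = 0].
Proof.
move=> /andP[t00 t0L]; set L := len e0 in t0L *.
have L0 : 0 < L := len_gt0 e0.
(* The tent vanishes at both ends of [e0], rises with slope [a] up to [t0] and falls with slope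
   [- b]. Unit mass at the peak requires [a + b = 1], and meeting at height [a * t0] while vanishing
   at [L] then requires [b * L = t0]. *)
pose b := t0 / L; pose a := 1 - b.
have bL : b * L = t0 by rewrite /b divfK // gt_eqF.
have b0 : 0 < b by rewrite divr_gt0.
have b1 : b < 1 by rewrite ltr_pdivrMr // mul1r.
pose u x := a * x + 0; pose w x := - b * x + t0.
pose phi e x := if e == e0 then Num.min (u x) (w x) else 0 * x + 0.
have phi0 e : phi e 0 = 0.
  by rewrite /phi /u /w !mulr0 add0r; case: ifP => // _; rewrite add0r min_l // ltW.
have phiL e : phi e (len e) = 0.
  rewrite /phi; case: eqP => [->|_]; last by rewrite mul0r add0r.
  rewrite /u /w -/L mulNr bL addNr min_r // addr0 mulr_ge0 //; last exact: ltW.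
  by rewrite /a subr_ge0 ltW.
pose f := edgewise (fun=> 0) phi.
have fE e t : 0 <= t <= len e -> f (edge_point e t) = phi e t.
  by apply: edgewiseE; rewrite ?phi0 ?phiL.
have gf e t s m : tangent (len e) t s -> germ (phi e) t s m ->
    germ (f \o edge_point e) t s m.
  by move=> [te st]; apply: eq_germ te st => x /fE.
have gu t s : germ u t s (s * a) by exact: germ_affine.
have gw t s : germ w t s (s * - b) by exact: germ_affine.
have glt t s : t < t0 -> germ (phi e0) t s (s * a).
  rewrite /phi eqxx => tt0; apply: germ_min_lt (gu t s) (gw t s).
  rewrite /u /w /a; lra.
have ggt t s : t0 < t -> germ (phi e0) t s (s * - b).
  rewrite /phi eqxx => tt0.
  have : germ (fun x => Num.min (w x) (u x)) t s (s * - b).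
    by apply: germ_min_lt (gw t s) (gu t s); rewrite /u /w /a; lra.
  by apply: filterS => h /=; rewrite minC [in X in _ = X -> _]minC.
have geq s : germ (phi e0) t0 s (Num.min (s * a) (s * - b)).
  rewrite /phi eqxx; apply: germ_min_eq => //.
  by rewrite /u /w /a; lra.
have gne e t s : e != e0 -> germ (phi e) t s 0.
  move=> /negbTE ne; rewrite /phi ne.
  by have := germ_affine 0 0 t s; rewrite mulr0.
exists f; split.
- apply/cpaP => e t s te.
  have [ee|ne] := eqVneq e e0; last by exists 0; apply: gf => //; exact: gne.
  subst e; have [tt0|tt0|tt0] := ltgtP t t0.
  + by exists (s * a); apply: gf => //; exact: glt.
  + by exists (s * - b); apply: gf => //; exact: ggt.
  + by rewrite tt0 in te *; exists (Num.min (s * a) (s * - b)); apply: gf => //; exact: geq.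
- rewrite div_edge_point; last by rewrite t00.
  rewrite (out_slopeE (gf _ _ _ _ (tangent_right (ltW t00) t0L) (geq 1))).
  rewrite (out_slopeE (gf _ _ _ _ (tangent_left t00 (ltW t0L)) (geq (-1)))).
  by rewrite min_r ?min_l; rewrite /a; lra.
- move=> e t te ne; rewrite div_edge_point //.
  have /andP[t1 tL] := te.
  have tr := tangent_right (ltW t1) tL; have tl := tangent_left t1 (ltW tL).
  have [ee|nee] := eqVneq e e0; last first.
    rewrite (out_slopeE (gf _ _ _ _ tr (gne _ _ _ nee))).
    by rewrite (out_slopeE (gf _ _ _ _ tl (gne _ _ _ nee))) addr0 oppr0.
  subst e; have [tt0|tt0|tt0] := ltgtP t t0.
  + rewrite (out_slopeE (gf _ _ _ _ tr (glt _ _ tt0))).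
    by rewrite (out_slopeE (gf _ _ _ _ tl (glt _ _ tt0))); ring.
  + rewrite (out_slopeE (gf _ _ _ _ tr (ggt _ _ tt0))).
    by rewrite (out_slopeE (gf _ _ _ _ tl (ggt _ _ tt0))); ring.
  + by rewrite tt0 in ne.
Qed.

(** Read at the vertices, [div (pl_ext x)] is the weighted graph Laplacian of [x], with conductances
    [1 / len e]. *)
Definition pl_ext (x : vertex G -> R) : gpoint G -> R :=
  edgewise x (fun e t => (x (tgt e) - x (src e)) / len e * t + x (src e)).

Lemma pl_extE x e t : 0 <= t <= len e ->
  pl_ext x (edge_point e t) = (x (tgt e) - x (src e)) / len e * t + x (src e).
Proof.
apply: edgewiseE; first by rewrite mulr0 add0r.
by rewrite divfK ?gt_eqF ?len_gt0 // subrK.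
Qed.

Lemma pl_ext_germ x e t s : tangent (len e) t s ->
  germ (pl_ext x \o edge_point e) t s (s * ((x (tgt e) - x (src e)) / len e)).
Proof.
move=> [te st]; apply: eq_germ te st (germ_affine _ (x (src e)) t s) => y /= y0.
by rewrite pl_extE.
Qed.

Lemma pl_ext_cpa x : continuous_pa (pl_ext x).
Proof. by apply/cpaP => e t s te; eexists; exact: pl_ext_germ. Qed.

Lemma div_pl_ext_interior x e t : 0 < t < len e -> div (pl_ext x) (edge_point e t) = 0.
Proof.
move=> te; have /andP[t0 tL] := te; rewrite div_edge_point //.
rewrite (out_slopeE (pl_ext_germ _ (tangent_right (ltW t0) tL))).
by rewrite (out_slopeE (pl_ext_germ _ (tangent_left t0 (ltW tL)))); ring.
Qed.

Lemma pl_extD x y : pl_ext (fun v => x v + y v) = pl_ext x + pl_ext y.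
Proof.
apply/funext => p; change (pl_ext (fun v => x v + y v) p = pl_ext x p + pl_ext y p).
by case: p => [v|e u] //=; ring.
Qed.

Lemma pl_extZ c x : pl_ext (fun v => c * x v) = (fun p => c * pl_ext x p).
Proof. by apply/funext => -[v|e u] //=; ring. Qed.

Lemma div_vertex_sum f : continuous_pa f ->
  (forall e t, 0 < t < len e -> div f (edge_point e t) = 0) ->
  \sum_v div f (Vertex v) = 0.
Proof.
move=> cf df; have [_ deg0] := Div_div cf.
rewrite -[RHS]deg0 (@degreeE _ _ _ [seq Vertex v | v <- enum (vertex G)]).
- by rewrite big_map big_enum.
- by rewrite map_inj_uniq ?enum_uniq // => u v [].
- move=> p; have [[v ->]|[e [t [te ->]]] _] := gpoint_cases p; last exact: df.
  by rewrite map_f // mem_enum.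
Qed.

(* The Laplacian has constant kernel by [div0_const], hence rank #|V| - 1, which
   is the rank of the space of vectors of sum 0 containing its image. *)
Lemma laplacian_surjective (y : vertex G -> R) : \sum_v y v = 0 ->
  exists x, forall v, div (pl_ext x) (Vertex v) = y v.
Proof.
move=> y0; pose N := #|vertex G|.
pose vx (u : 'rV[R]_N) (v : vertex G) := u 0 (enum_rank v).
pose F (u : 'rV[R]_N) : 'rV[R]_N := \row_j div (pl_ext (vx u)) (Vertex (enum_val j)).
have FD u w : F (u + w) = F u + F w.
  apply/rowP => j; rewrite !mxE.
  have -> : vx (u + w) = fun v => vx u v + vx w v by apply/funext => v; rewrite /vx mxE.
  by rewrite pl_extD divD //; exact: pl_ext_cpa.
have FZ c u : F (c *: u) = c *: F u.
  apply/rowP => j; rewrite !mxE.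
  have -> : vx (c *: u) = fun v => c * vx u v by apply/funext => v; rewrite /vx mxE.
  by rewrite pl_extZ divZ //; exact: pl_ext_cpa.
have Flin : linear F by move=> c u w; rewrite FD FZ.
pose Fl : {linear 'rV[R]_N -> 'rV[R]_N} := HB.pack F (GRing.isLinear.Build _ _ _ _ F Flin).
pose A := lin1_mx Fl.
have FA u : u *m A = F u by rewrite mul_rV_lin1.
(* [kermx one] is the hyperplane of row vectors with coordinate sum 0; [A1] puts the image of the
   Laplacian in it because principal divisors have degree 0. *)
pose one : 'cV[R]_N := const_mx 1.
have A1 : A *m one = 0.
  apply/row_matrixP => i; rewrite row_mul row0 rowE FA.
  apply/matrixP => a b; rewrite !mxE.
  transitivity (\sum_v div (pl_ext (vx (delta_mx 0 i))) (Vertex v)); last first.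
    apply: div_vertex_sum; first exact: pl_ext_cpa.
    by move=> e t; exact: div_pl_ext_interior.
  rewrite (reindex (@enum_val _ (vertex G))) /=; last exact: onW_bij (enum_val_bij _).
  by apply: eq_bigr => j _; rewrite !mxE mulr1.
have N0 : (0 < N)%N := vertex_gt0 G.
have rone : \rank one = 1%N.
  apply/eqP; rewrite eqn_leq rank_leq_col lt0n mxrank_eq0.
  apply/eqP => /matrixP/(_ (Ordinal N0) 0); rewrite !mxE => /eqP; by rewrite oner_eq0.
have kerF u : F u = 0 -> u = u 0 (Ordinal N0) *: const_mx 1.
  move=> Fu; have du : div (pl_ext (vx u)) = 0.
    apply/funext => p; have [[v ->]|[e [t [te ->]]]] := gpoint_cases p.
      by have /rowP/(_ (enum_rank v)) := Fu; rewrite !mxE enum_rankK.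
    exact: div_pl_ext_interior.
  have uc := div0_const (pl_ext_cpa _) du.
  apply/rowP => j; rewrite !mxE mulr1.
  have := uc (Vertex (enum_val j)) (Vertex (enum_val (Ordinal N0))).
  by rewrite /= /vx !enum_valK.
have rker : (\rank (kermx A) <= 1)%N.
  suff /mxrankS : (kermx A <= (const_mx 1 : 'rV[R]_N))%MS.
    by move=> /leq_trans; apply; exact: rank_leq_row.
  apply/row_subP => i; rewrite (kerF (row i _)) ?scalemx_sub //.
  by rewrite -FA; apply/sub_kermxP; exact: row_sub.
have AK : (A <= kermx one)%MS by apply/sub_kermxP.
have /eqmxP/eqmx_sym KA : (A == kermx one)%MS.
  rewrite -(mxrank_leqif_eq AK) eqn_leq mxrankS //=.
  rewrite mxrank_ker rone leq_subLR.
  by move: rker; rewrite mxrank_ker leq_subLR addnC.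
pose yr : 'rV[R]_N := \row_j y (enum_val j).
have : (yr <= A)%MS.
  rewrite -KA; apply/sub_kermxP; apply/matrixP => a b; rewrite !mxE -[RHS]y0.
  rewrite (reindex (@enum_val _ (vertex G))) /=; last exact: onW_bij (enum_val_bij _).
  by apply: eq_bigr => j _; rewrite !mxE mulr1.
case/submxP => u Hu; exists (vx u) => v.
have /rowP/(_ (enum_rank v)) := Hu; by rewrite FA !mxE enum_rankK.
Qed.

(** Subtracting a multiple of a tent clears one interior point of the support at the price of
    changing the values at vertices. Once no interior mass is left, the Laplacian applies. *)
Lemma potential_exists (D : gpoint G -> R) : Div 0 D ->
  exists2 f, continuous_pa f & div f = D.
Proof.
move=> hD; have [/finite_suppP[s0 _ H0] _] := hD.
(* The induction list has to cover only the interior part of the support: the tents may create new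
   support at the vertices. *)
have : exists r : seq (gpoint G), forall e t, 0 < t < len e -> edge_point e t \notin r ->
    D (edge_point e t) = 0 by exists s0 => e t _ /H0.
case=> r {s0 H0}; elim: r D hD => [|p r IH] D hD Hs.
  have [|x Hx] := @laplacian_surjective (fun v => D (Vertex v)).
    have [_ deg0] := hD; rewrite -[RHS]deg0 (@degreeE _ _ _ [seq Vertex v | v <- enum (vertex G)]).
    - by rewrite big_map big_enum.
    - by rewrite map_inj_uniq ?enum_uniq // => u v [].
    - move=> p; have [[v ->]|[e [t [te ->]]] _] := gpoint_cases p; last exact: Hs.
      by rewrite map_f // mem_enum.
  exists (pl_ext x); first exact: pl_ext_cpa.
  apply/funext => p; have [[v ->]|[e [t [te ->]]]] := gpoint_cases p => //.
  by rewrite div_pl_ext_interior // Hs.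
have [[v pv]|[e0 [t0 [te0 pe]]]] := gpoint_cases p; last subst p.
  apply: IH => // e t te ts; apply: Hs => //; rewrite inE negb_or ts andbT pv.
  by apply/eqP; rewrite /edge_point insubT.
have [f1 [cf1 f1p f1n]] := tent_exists te0.
pose c := D (edge_point e0 t0); pose g1 := fun q => c * div f1 q.
have [| |f' cf' df'] := IH (D - g1).
- by have := DivB hD (DivZ c (Div_div cf1)); rewrite mulr0 subr0.
- move=> e t te ts; change (D (edge_point e t) - c * div f1 (edge_point e t) = 0).
  have [e1|ne] := pselect (edge_point e t = edge_point e0 t0).
    by rewrite e1 f1p mulr1 subrr.
  rewrite f1n // mulr0 subr0; apply: Hs => //; rewrite inE negb_or ts andbT.
  exact/eqP.
exists (f' + (fun q => c * f1 q)); first by apply: cpaD => //; exact: cpaZ.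
by rewrite divD ?divZ //; [rewrite df' subrK|exact: cpaZ].
Qed.

End Existence.

(** * Minima, segments and integrals *)

Section Potential.
Variables (R : realType) (G : metricGraph R).
Implicit Types (f g : gpoint G -> R) (e : edge G) (t s m c : R) (p : gpoint G).

Lemma potentialP (D : gpoint G -> R) : Div 0 D ->
  continuous_pa (potential D) /\ div (potential D) = D.
Proof.
move=> /potential_exists[f cf df]; rewrite /potential.
have : exists f, [set f | continuous_pa f /\ div f = D] f by exists f.
exact: xgetPex.
Qed.

Lemma div_inj f g : continuous_pa f -> continuous_pa g -> div f = div g ->
  exists c, f = g + cst c.
Proof.
move=> cf cg fg; have /card_gt0P[v _] := vertex_gt0 G.
have H := div0_const (cpaB cf cg) _.
exists (f (Vertex v) - g (Vertex v)); apply/funext => p.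
have : f p - g p = f (Vertex v) - g (Vertex v) by apply: H; rewrite divB // fg subrr.
by move=> E; change (f p = g p + (f (Vertex v) - g (Vertex v))); rewrite -E; ring.
Qed.

Lemma potential_div f : continuous_pa f -> exists c, potential (div f) = f + cst c.
Proof.
by move=> cf; have [cp dp] := potentialP (Div_div cf); exact: div_inj.
Qed.

Lemma cpa_shift f c : continuous_pa f -> continuous_pa (f + cst c).
Proof. by move=> cf; apply: cpaD => //; exact: cpa_cst. Qed.

Lemma div_shift f c : continuous_pa f -> div (f + cst c) = div f.
Proof. by move=> cf; rewrite divD ?div_cst ?addr0 //; exact: cpa_cst. Qed.

Lemma argmin_exists f : continuous_pa f -> exists p, argmin f p.
Proof.
move=> [cf _].
have /choice[T HT] : forall e, exists t, forall x, 0 <= x <= len e ->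
    f (edge_point e t) <= f (edge_point e x).
  move=> e; have [t _ Ht] := EVT_min (ltW (len_gt0 e)) (cf e).
  by exists t => x xe; apply: Ht; rewrite in_itv.
(* Finitely many candidates: the vertices and one minimizer per edge. Listing the vertices also
   covers a graph without edges. *)
pose P (i : vertex G + edge G) := match i with inl v => Vertex v | inr e => edge_point e (T e) end.
have /card_gt0P[v _] := vertex_gt0 G.
have [i _ Hi] := @Order.TotalTheory.arg_minP _ _ _ (inl v) predT (fun i => f (P i)) isT.
exists (P i) => q; have [[w ->]|[e [t [te ->]]]] := gpoint_cases q.
  exact: (Hi (inl w)).
by apply: le_trans (Hi (inr e) isT) _; apply: HT; lra.
Qed.

Lemma gminE f p : argmin f p -> gmin f = f p.
Proof.
move=> fp; apply/le_anti/andP; split.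
  by apply: ge_inf; [exists (f p) => _ [q _ <-]|exists p].
by apply: lb_le_inf; [exists (f p), p|move=> _ [q _ <-]].
Qed.

Lemma argmin_shift f c : argmin (f + cst c) = argmin f.
Proof.
by apply/seteqP; split=> p fp q; have := fp q; rewrite !fctE /cst lerD2r.
Qed.

Lemma underline_shift f c : continuous_pa f -> underline (f + cst c) = underline f.
Proof.
move=> cf; have [p fp] := argmin_exists cf; apply/funext => q.
have fp' : argmin (f + cst c) p by rewrite argmin_shift.
rewrite /underline (gminE fp) (gminE fp').
by change (f q + c - (f p + c) = f q - f p); ring.
Qed.

Lemma underlineE f : underline f = f + cst (- gmin f).
Proof. by []. Qed.

Lemma underline_ge0 f p : continuous_pa f -> 0 <= underline f p.
Proof. by move=> cf; have [q fq] := argmin_exists cf; rewrite /underline (gminE fq) subr_ge0. Qed.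

Lemma underline_argmin f p : argmin f p -> underline f p = 0.
Proof. by move=> fp; rewrite /underline (gminE fp) subrr. Qed.

Lemma gmax_ge f p : continuous_pa f -> f p <= gmax f.
Proof.
move=> cf; have [q fq] := argmin_exists (cpaZ (-1) cf).
apply: ub_le_sup; last by exists p.
by exists (f q) => _ [r _ <-]; have := fq r; rewrite !mulN1r lerN2.
Qed.

Lemma gmin_le_gmax f : continuous_pa f -> gmin f <= gmax f.
Proof. by move=> cf; have [q fq] := argmin_exists cf; rewrite (gminE fq); exact: gmax_ge. Qed.

Lemma tsegment_min (E g1 g2 : gpoint G -> R) c1 c2 : continuous_pa g1 -> continuous_pa g2 ->
  tsegment (E + div g1) (E + div g2)
    (E + div ((g1 + cst c1) \min (g2 + cst c2))).
Proof.
move=> cg1 cg2; rewrite /tsegment /=.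
have -> : E + div g2 - (E + div g1) = div (g2 - g1).
  by rewrite divB // opprD addrACA subrr add0r.
have c21 := cpaB cg2 cg1; have [k ->] := potential_div c21.
set f := g2 - g1 + cst k; have cf : continuous_pa f by exact: cpa_shift.
pose l := gmax f - gmin f; have l0 : 0 <= l by rewrite subr_ge0 gmin_le_gmax.
(* This value makes [min(g1 + c1, g2 + c2)] equal to [g1 + (c1 - t) + min(t, underline f)]. Clamping
   it to [[0, l]] costs a further constant, invisible to [div]. *)
pose t := c1 - c2 + k - gmin f.
pose t' := Num.max 0 (Num.min t l).
exists t'.
  rewrite /= in_itv /=; apply/andP; split; first by rewrite le_max lexx.
  by rewrite ge_max l0 ge_min lexx orbT.
have cu : continuous_pa (fun p => Num.min t' (underline f p)).
  by apply: (cpa_min (cpa_cst _ t')); rewrite underlineE; exact: cpa_shift.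
have -> : (g1 + cst c1) \min (g2 + cst c2) =
    g1 + (fun p => Num.min t' (underline f p)) + cst (c1 - t + Num.min t 0).
  apply/funext => p; change (Num.min (g1 p + c1) (g2 p + c2) =
    g1 p + Num.min t' (underline f p) + (c1 - t + Num.min t 0)).
  have H := @min_clamp _ t l (underline f p) (underline_ge0 _ cf) _.
  have -> : g1 p + c1 = (g1 p + (c1 - t)) + t by ring.
  have -> : g2 p + c2 = (g1 p + (c1 - t)) + underline f p.
    rewrite /underline; change (g2 p + c2 = g1 p + (c1 - t) + (g2 p - g1 p + k - gmin f)).
    by rewrite /t; ring.
  by rewrite -addr_minr H ?lerD2r ?gmax_ge // /t'; ring.
by rewrite div_shift; [rewrite divD // addrC addrA|exact: cpaD].
Qed.

Lemma tsegmentP (E g1 g2 X : gpoint G -> R) : continuous_pa g1 -> continuous_pa g2 ->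
  tsegment (E + div g1) (E + div g2) X ->
  exists c1 c2, X = E + div ((g1 + cst c1) \min (g2 + cst c2)).
Proof.
move=> cg1 cg2; rewrite /tsegment /=.
have -> : E + div g2 - (E + div g1) = div (g2 - g1).
  by rewrite divB // opprD addrACA subrr add0r.
have c21 := cpaB cg2 cg1; have [k ->] := potential_div c21.
set f := g2 - g1 + cst k; have cf : continuous_pa f by exact: cpa_shift.
move=> [t _ <-]; exists t, (k - gmin f).
have cu : continuous_pa (fun p => Num.min t (underline f p)).
  by apply: (cpa_min (cpa_cst _ t)); rewrite underlineE; exact: cpa_shift.
have -> : (g1 + cst t) \min (g2 + cst (k - gmin f)) =
    g1 + (fun p => Num.min t (underline f p)).
  apply/funext => p; rewrite /underline /f.
  change (Num.min (g1 p + t) (g2 p + (k - gmin f)) =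
          g1 p + Num.min t (g2 p - g1 p + k - gmin f)).
  by rewrite addr_minr; congr Num.min; ring.
by rewrite divD // addrC addrA.
Qed.

End Potential.

Section Integral.
Variables (R : realType) (G : metricGraph R).
Implicit Types (f g : gpoint G -> R) (e : edge G).

Lemma cpa_integrable f e : continuous_pa f ->
  lebesgue_measure.-integrable `[0, len e] (EFin \o (f \o edge_point e)).
Proof.
move=> [cf _]; apply: continuous_compact_integrable; first exact: segment_compact.
exact: cf.
Qed.

Lemma graph_integral_le f g : continuous_pa f -> continuous_pa g ->
  (forall p, f p <= g p) -> graph_integral f <= graph_integral g.
Proof.
move=> cf cg fg; apply: ler_sum => e _.
by apply: le_Rintegral => //; [exact: cpa_integrable|exact: cpa_integrable].
Qed.

Lemma Rintegral_gt0 (phi : R -> R) (L a b c : R) :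
  lebesgue_measure.-integrable `[0, L] (EFin \o phi) ->
  0 <= a -> a < b -> b <= L -> 0 < c ->
  (forall x, 0 <= x <= L -> 0 <= phi x) -> (forall x, a <= x <= b -> c <= phi x) ->
  0 < \int[lebesgue_measure]_(x in `[0, L]) phi x.
Proof.
move=> iphi a0 ab bL c0 phi0 phic.
have sub : `[a, b] `<=` `[0, L].
  by move=> x /=; rewrite !in_itv /= => /andP[? ?]; apply/andP; split; lra.
have iab : lebesgue_measure.-integrable `[a, b] (EFin \o phi).
  by apply: integrableS iphi.
apply: (@lt_le_trans _ _ (\int[lebesgue_measure]_(x in `[a, b]) phi x)).
  apply: (@lt_le_trans _ _ (\int[lebesgue_measure]_(x in `[a, b]) c)).
    rewrite Rintegral_cst //= lebesgue_measure_itv /= lte_fin ab /=.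
    by rewrite mulr_gt0 // subr_gt0.
  apply: le_Rintegral => //.
  apply: continuous_compact_integrable; first exact: segment_compact.
  by apply/continuous_subspaceT => x; exact: cvg_cst.
apply: fine_le; [exact: integrable_fin_num|exact: integrable_fin_num|].
apply: ge0_subset_integral => //.
exact: (measurable_int lebesgue_measure).
Qed.

(** A gap at one point persists on a short interval beside it, which makes the integrals differ.
    Equality is claimed along edges only: on a graph without edges the integral does not see the
    single vertex. *)
Lemma graph_integral_strict f g : continuous_pa f -> continuous_pa g ->
  (forall p, f p <= g p) -> graph_integral g <= graph_integral f ->
  forall e (t : R), 0 <= t <= len e -> f (edge_point e t) = g (edge_point e t).
Proof.
move=> cf cg fg gf e t te; apply/eqP; rewrite eq_le fg /= leNgt; apply/negP => lt.
suff : graph_integral f < graph_integral g by rewrite ltNge gf.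
have le1 e' : \int[lebesgue_measure]_(x in `[0, len e']) f (edge_point e' x) <=
    \int[lebesgue_measure]_(x in `[0, len e']) g (edge_point e' x).
  by apply: le_Rintegral => //; exact: cpa_integrable.
rewrite /graph_integral (bigD1 e) //= [ltRHS](bigD1 e) //=.
apply: ltr_leD; last by apply: ler_sum.
rewrite -subr_gt0 -RintegralB //; [|exact: cpa_integrable|exact: cpa_integrable].
(* Half the gap at [t]: an affine germ of [g - f] loses less than [c] over a short enough interval,
   hence stays above [c]. *)
pose c := (g (edge_point e t) - f (edge_point e t)) / 2.
have c0 : 0 < c by rewrite divr_gt0 // subr_gt0.
have [a [b [a0 ab bL H]]] : exists a b, [/\ 0 <= a, a < b, b <= len e &
    forall x, a <= x <= b -> c <= g (edge_point e x) - f (edge_point e x)].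
  have cgf := cpaB cg cf.
  have near_t s m : germ ((g - f) \o edge_point e) t s m ->
      (s = 1 /\ t < len e) \/ (s = -1 /\ 0 < t) ->
      exists2 h, 0 < h & 0 < t + s * h < len e /\
        forall x, 0 <= x <= h -> c <= g (edge_point e (t + s * x)) - f (edge_point e (t + s * x)).
    move=> /germ_itv gm st.
    have [h [[[/= H hi] hm] h0]] := filter_ex (filterI (filterI (filterI gm
      (near_tangent te st)) (near_scale_lt m c0)) (nbhs_right_gt 0)).
    exists h => //; split=> // x xh.
    have -> : g (edge_point e (t + s * x)) - f (edge_point e (t + s * x)) =
        g (edge_point e t) - f (edge_point e t) + m * x by exact: H.
    have : `|m * x| <= `|m * h| by rewrite !normrM ler_wpM2l // !ger0_norm; lra.
    have := ler_norm (- (m * x)); rewrite normrN.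
    by rewrite /c in hm *; lra.
  have [tL|tL] := ltP t (len e).
    have t0 : 0 <= t by lra.
    have [h h0 [hi H]] := near_t _ _ (out_slopeP cgf (tangent_right t0 tL)) (or_introl (conj erefl tL)).
    exists t, (t + h); split; [lra|lra|lra|move=> x xth].
    have -> : x = t + 1 * (x - t) by ring.
    by apply: H; lra.
  have t0 : 0 < t by have := len_gt0 e; lra.
  have tL' : t <= len e by lra.
  have [h h0 [hi H]] := near_t _ _ (out_slopeP cgf (tangent_left t0 tL')) (or_intror (conj erefl t0)).
  exists (t - h), t; split; [lra|lra|lra|move=> x xth].
  have -> : x = t + -1 * (t - x) by ring.
  by apply: H; lra.
apply: (Rintegral_gt0 _ a0 ab bL c0) => //.
- have := cpa_integrable e (cpaB cg cf); exact.
- by move=> x _; rewrite subr_ge0.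
Qed.

End Integral.

(** * Tropical polytopes *)

Section TropicalPolytope.
Variables (R : realType) (G : metricGraph R) (d : R).
Implicit Types (f g h : gpoint G -> R) (D E : gpoint G -> R)
  (A : set (gpoint G -> R)) (p q : gpoint G).

Definition potentials E A : set (gpoint G -> R) :=
  [set f | continuous_pa f /\ A (E + div f)].

(* [potentials E A] is stable under adding constants, so its [min_span] consists
   of all the tropical combinations min_i (f_i + c_i). *)
Inductive min_span (F : set (gpoint G -> R)) : (gpoint G -> R) -> Prop :=
  | min_span_gen f : F f -> min_span F f
  | min_span_min f g : min_span F f -> min_span F g -> min_span F (f \min g).

Lemma min_span_cpa E A g : min_span (potentials E A) g -> continuous_pa g.
Proof. by elim=> [f []|f h _ cf _ ch] //; exact: cpa_min. Qed.

Lemma min_span_shift E A g c :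
  min_span (potentials E A) g -> min_span (potentials E A) (g + cst c).
Proof.
elim=> [f [cf Af]|f h _ cf _ ch].
  by apply: min_span_gen; split; [exact: cpa_shift|rewrite div_shift].
have -> : (f \min h) + cst c = (f + cst c) \min (h + cst c).
  by apply/funext => p; exact: addr_minl.
exact: min_span_min.
Qed.

(** A minimum is attained at each point by one of its terms. This contact from above replaces
    explicit families of coefficients in the arguments that follow. *)
Lemma min_span_touch F g p : min_span F g ->
  exists f, [/\ F f, f p = g p & forall q, g q <= f q].
Proof.
elim=> [f Ff|f h _ [f1 [F1 e1 l1]] _ [f2 [F2 e2 l2]]]; first by exists f.
have [fh|hf] := leP (f p) (h p).
  exists f1; split => // [|q]; first by rewrite e1 /= min_l.
  by rewrite ge_min l1.
exists f2; split => // [|q]; first by rewrite e2 /= min_r // ltW.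
by rewrite ge_min l2 orbT.
Qed.

Lemma min_span_eff E A g : A `<=` eff_Div d -> Div d E ->
  min_span (potentials E A) g -> eff_Div d (E + div g).
Proof.
move=> Aeff dE sg; split.
  by have := DivD dE (Div_div (min_span_cpa sg)); rewrite addr0.
elim: sg => [f [_ /Aeff[]] //|f h sf ef sh eh p].
have cf := min_span_cpa sf; have ch := min_span_cpa sh.
have [fh|/ltW hf] := leP (f p) (h p).
  by apply: le_trans (ef p) _; rewrite lerD2l; exact: div_min_ge.
apply: le_trans (eh p) _; rewrite lerD2l.
have -> : f \min h = h \min f by apply/funext => q /=; rewrite minC.
exact: div_min_ge.
Qed.

(** Both inclusions rest on segments being exactly the two-term minima. [E] is an arbitrary base
    point of degree [d]: the divisor to be projected, or a generator when extremality is tested. *)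
Lemma tconvE E A : A `<=` eff_Div d -> Div d E ->
  tconv d A = [set E + div g | g in min_span (potentials E A)] /\
  tropically_convex d (tconv d A).
Proof.
move=> Aeff dE; set C := [set _ | _ in _].
have CA : tropically_convex d C.
  split=> [_ [g sg <-]|_ _ [g1 s1 <-] [g2 s2 <-] X]; first exact: min_span_eff sg.
  move=> /(tsegmentP (min_span_cpa s1) (min_span_cpa s2))[c1 [c2 ->]].
  by exists ((g1 + cst c1) \min (g2 + cst c2)) => //; apply: min_span_min; exact: min_span_shift.
suff -> : tconv d A = C by [].
apply/seteqP; split.
  apply: smallest_sub => // D AD.
  have [dD _] := Aeff _ AD; have := DivB dD dE; rewrite subrr => /potential_exists[f cf df].
  have DE : E + div f = D by rewrite df addrC subrK.
  by exists f => //; apply: min_span_gen; split => //; rewrite DE.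
move=> _ [g sg <-] T [cT AT].
elim: sg => [f [_ /AT] //|f h sf Tf sh Th].
(* Zero shifts suffice, since constants are already absorbed into the generating potentials. *)
have := tsegment_min E 0 0 (min_span_cpa sf) (min_span_cpa sh).
have -> : (cst 0 : gpoint G -> R) = 0 by [].
by rewrite !addr0; exact: cT.2.
Qed.

Lemma tconv_mono A B : A `<=` B -> tconv d A `<=` tconv d B.
Proof. by move=> AB D AD T [cT BT]; apply: AD; split => //; exact: subset_trans BT. Qed.

Lemma potential_add E g : continuous_pa g -> exists c, potential (E + div g - E) = g + cst c.
Proof. by move=> cg; rewrite [E + _]addrC addrK; exact: potential_div. Qed.

Lemma argmin_potential E g : continuous_pa g ->
  argmin (potential (E + div g - E)) = argmin g.
Proof. by move=> cg; have [c ->] := potential_add E cg; exact: argmin_shift. Qed.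

Lemma underline_potential E g : continuous_pa g ->
  underline (potential (E + div g - E)) = underline g.
Proof. by move=> cg; have [c ->] := potential_add E cg; exact: underline_shift. Qed.

Lemma proj_functionalE E g : continuous_pa g ->
  proj_functional E (E + div g) = graph_integral (underline g).
Proof. by move=> cg; rewrite /proj_functional underline_potential. Qed.

Lemma argmin_le f g p : (forall q, g q <= f q) -> f p = g p -> argmin g p -> argmin f p.
Proof. by move=> gf e gp q; rewrite e (le_trans (gp q)). Qed.

Lemma underline_le f g p : continuous_pa f -> continuous_pa g ->
  (forall q, g q <= f q) -> f p = g p -> underline f p <= underline g p.
Proof.
move=> cf cg gf e; have [q fq] := argmin_exists cf; have [r gr] := argmin_exists cg.
by rewrite /underline (gminE fq) (gminE gr) e lerD2l lerN2 (le_trans (gr q)).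
Qed.

Lemma argmin_underline f p : continuous_pa f -> underline f p = 0 -> argmin f p.
Proof.
move=> cf; have [q fq] := argmin_exists cf.
by rewrite /underline (gminE fq) => /eqP; rewrite subr_eq0 => /eqP e r; rewrite e.
Qed.

Lemma lower_envelope E (s : seq (gpoint G -> R)) : [set` s] `<=` eff_Div d -> Div d E ->
  s != [::] -> exists h, [/\ min_span (potentials E [set` s]) h,
    forall p, exists2 D, D \in s & h p = underline (potential (D - E)) p &
    forall p D, D \in s -> h p <= underline (potential (D - E)) p].
Proof.
move=> seff dE.
have us D : D \in s -> min_span (potentials E [set` s]) (underline (potential (D - E))).
  move=> Ds; have [dD _] := seff _ Ds; have := DivB dD dE.
  rewrite subrr => /potentialP[cD eD].
  by apply: min_span_shift; apply: min_span_gen; split => //; rewrite eD addrC subrK.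
(* The potentials refer to the whole list; naming them [F] keeps them fixed while the induction
   shortens the list. *)
have : forall D, D \in s -> min_span (potentials E [set` s]) (underline (potential (D - E))) by [].
move: {us}(potentials E [set` s]) => F {seff}.
elim: s => // D [|D' s] IH us _.
  exists (underline (potential (D - E))); split=> [|p|p D0]; first exact/us/mem_head.
    by exists D => //; exact: mem_head.
  by rewrite inE => /eqP ->.
have [|//|h [sh eh lh]] := IH; first by move=> D0 D0s; apply: us; rewrite inE D0s orbT.
exists (underline (potential (D - E)) \min h); split.
- by apply: min_span_min => //; exact/us/mem_head.
- move=> p /=; have [_|_] := leP (underline (potential (D - E)) p) (h p).
    by exists D => //; exact: mem_head.
  by have [D0 D0s ->] := eh p; exists D0 => //; rewrite inE D0s orbT.
- move=> p D0; rewrite inE => /predU1P[->|D0s]; first by rewrite ge_min lexx.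
  by rewrite ge_min lh ?orbT.
Qed.

Lemma lower_envelope_spec E (s : seq (gpoint G -> R)) : [set` s] `<=` eff_Div d -> Div d E ->
  s != [::] -> exists h, [/\ min_span (potentials E [set` s]) h,
    forall p, h p = 0 <-> exists2 D, D \in s & argmin (potential (D - E)) p,
    underline h = h &
    forall g, min_span (potentials E [set` s]) g -> forall p, h p <= underline g p].
Proof.
move=> seff dE s0; have [h [sh eh lh]] := lower_envelope seff dE s0.
have ch := min_span_cpa sh.
have cD D : D \in s -> continuous_pa (potential (D - E)).
  move=> Ds; have [dD _] := seff _ Ds; have := DivB dD dE.
  by rewrite subrr => /potentialP[].
have h0 p : 0 <= h p by have [D /cD cDE ->] := eh p; exact: underline_ge0.
have hp p : h p = 0 <-> exists2 D, D \in s & argmin (potential (D - E)) p.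
  split=> [|[D Ds Dp]].
    by have [D Ds ->] := eh p => /(argmin_underline (cD _ Ds)) ?; exists D.
  by apply/le_anti; rewrite h0 andbT -(underline_argmin Dp) lh.
exists h; split => //.
  case: s s0 {seff sh lh} eh cD hp => // D s _ _ cD hp.
  have [p Dp] := argmin_exists (cD _ (mem_head _ _)).
  have hp0 : h p = 0 by apply/hp; exists D => //; exact: mem_head.
  have am : argmin h p by move=> q; rewrite hp0.
  by apply/funext => q; rewrite /underline (gminE am) hp0 subr0.
(* With [f] touching [g] from above at [p], the chain at [p] is
   [h <= underline f <= underline g]. *)
move=> g sg p; have [f [[cf Af] fp gf]] := min_span_touch p sg.
apply: le_trans (underline_le cf (min_span_cpa sg) gf fp).
by rewrite -(underline_potential E cf); apply: lh.
Qed.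

(** If [E = E + div g], then [g] is constant, so every point minimizes [g] and hence also the
    generator touching [g] there. Conversely, a cover makes the lower envelope vanish
    identically. *)
Lemma tconv_cover E (s : seq (gpoint G -> R)) : [set` s] `<=` eff_Div d -> Div d E ->
  tconv d [set` s] E <-> forall p, exists2 D, D \in s & argmin (potential (D - E)) p.
Proof.
move=> seff dE; have [-> _] := tconvE seff dE; split.
  case=> g sg gE p.
  have dg : div g = 0 by apply: (addrI E); rewrite gE addr0.
  have cg := min_span_cpa sg.
  have [f [[cf Af] fp gf]] := min_span_touch p sg.
  exists (E + div f) => //; rewrite argmin_potential //.
  by apply: argmin_le gf fp _ => q; rewrite (div0_const cg dg p q).
move=> cover.
have [|h [sh h0 _ _]] := lower_envelope_spec seff dE.
  have /card_gt0P[v _] := vertex_gt0 G.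
  by have [D] := cover (Vertex v); case: s {seff cover}.
exists h => //.
have -> : h = cst 0 by apply/funext => p; apply/h0.
by rewrite div_cst addr0.
Qed.

(* With min h = 0, h is below every underline g, so the integral is minimal
   exactly at h. *)
Lemma tropical_projectionE E (s : seq (gpoint G -> R)) : [set` s] `<=` eff_Div d -> Div d E ->
  s != [::] -> exists h, [/\ continuous_pa h,
    tropical_projection (tconv d [set` s]) E = E + div h,
    argmin h = [set p | exists2 D, D \in s & argmin (potential (D - E)) p] &
    forall g, min_span (potentials E [set` s]) g -> argmin g `<=` argmin h].
Proof.
move=> seff dE s0; have [h [sh h0 uh lh]] := lower_envelope_spec seff dE s0.
have ch := min_span_cpa sh.
have amh p : argmin h p <-> h p = 0.
  split=> [/underline_argmin|hp0]; first by rewrite uh.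
  by apply: argmin_underline => //; rewrite uh.
exists h; split => //; last 2 first.
- apply/seteqP; split=> p; first by move=> /amh/h0.
  by move=> /h0/amh.
- move=> g sg p /underline_argmin gp; apply/amh/le_anti.
  by rewrite -{1}gp lh //= -uh underline_ge0.
have [TE _] := tconvE seff dE; rewrite TE; set T := [set _ | _ in _].
have cu g : continuous_pa g -> continuous_pa (underline g).
  by move=> cg; exact: cpa_shift.
have mh : proj_minimizer T E (E + div h).
  split; first by exists h.
  move=> _ [g sg <-]; rewrite !proj_functionalE ?(min_span_cpa sg) //; last exact: min_span_cpa sg.
  rewrite uh; apply: graph_integral_le => //; last exact: lh.
  exact/cu/(min_span_cpa sg).
have uniq_min D : proj_minimizer T E D -> D = E + div h.
  case=> -[g sg <-] /(_ _ mh.1); have cg := min_span_cpa sg.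
  rewrite !proj_functionalE // uh => le_gh; congr (_ + _).
  rewrite -(div_shift (- gmin g) cg) -underlineE; apply/funext => p.
  (* Slopes are taken along edges, so equality along edges is enough to identify the divisors. *)
  apply: eq_div => e t u te _.
  have /= hg := graph_integral_strict ch (cu _ cg) (lh _ sg) le_gh.
  apply: out_slopeE; have [te1 te2] := te.
  by apply: eq_germ te1 te2 (out_slopeP (cu _ cg) te) => x /= xe; rewrite hg.
by apply: xget_unique => [|D [/uniq_min]] //; split=> // D /uniq_min.
Qed.

(* T \ D is tropically convex: if D lay in a segment [X1, X2] of T avoiding D at
   its ends, the minimizers of the potentials of the generators other than D would
   cover the graph. *)
Lemma extremal_of_irredundant (s : seq (gpoint G -> R)) D : [set` s] `<=` eff_Div d ->
  D \in s -> ~ tconv d ([set` s] `\ D) D -> extremals d (tconv d [set` s]) D.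
Proof.
move=> seff Ds nD; have [dD _] := seff _ Ds.
have [TE cT] := tconvE seff dD; set T := tconv d [set` s] in TE cT *.
have TD : T D by apply: sub_gen_smallest.
split=> //.
suff cTD : tropically_convex d (T `\ D).
  by move=> /(_ _ (conj cTD (fun _ => id)))[_]; apply.
(* If the generator touching [g] at its minimizer [p] were [D], then [f] would be constant with
   value [min g]. Squeezed between its minimum and [f], [g] would equal [f], against
   [D + div g <> D]. *)
have away g p : min_span (potentials D [set` s]) g -> D + div g <> D -> argmin g p ->
    exists2 D', D' \in [seq D' <- s | D' != D] & argmin (potential (D' - D)) p.
  move=> sg gD gp; have [f [[cf sf] fp gf]] := min_span_touch p sg.
  exists (D + div f); last by rewrite argmin_potential //; exact: argmin_le gf fp gp.
  rewrite mem_filter sf andbT; apply/eqP => fD; apply: gD.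
  have df : div f = 0 by apply: (addrI D); rewrite fD addr0.
  suff -> : g = f by [].
  apply/funext => q; apply/le_anti; rewrite gf /= (div0_const cf df q p) fp.
  exact: gp.
split=> [X [/cT.1] //|X1 X2]; rewrite TE in cT * => -[[g1 s1 <-] n1] [[g2 s2 <-] n2] X.
have c1 := min_span_cpa s1; have c2 := min_span_cpa s2.
move=> X12; split; first by apply: (cT.2 _ _ _ _ _ X12); [exists g1|exists g2].
move=> XD; have XD' : X = D := XD; rewrite {}XD' {XD} in X12.
have [k1 [k2 E12]] := tsegmentP c1 c2 X12.
set m := _ \min _ in E12.
have cm : continuous_pa m by apply: cpa_min; exact: cpa_shift.
have dm : div m = 0 by apply: (addrI D); rewrite -E12 addr0.
have mc := div0_const cm dm.
apply: nD.
have -> : [set` s] `\ D = [set` [seq D' <- s | D' != D]].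
  apply/seteqP; split=> D' /=; rewrite mem_filter.
    by case=> -> /eqP ->.
  by case/andP => /eqP ? ->.
apply/tconv_cover => // [D' /=|p]; first by rewrite mem_filter => /andP[_ /seff].
(* As [m] is constant, whichever term attains it at [p] is minimal there: at any other [q] it is
   still at least [m q = m p]. *)
have [l12|l21] := leP (g1 p + k1) (g2 p + k2).
  apply: (away g1) => // q; rewrite -(lerD2r k1).
  have <- : m p = g1 p + k1 by exact: min_l.
  by rewrite (mc p q) ge_min lexx.
apply: (away g2) => // q; rewrite -(lerD2r k2).
have <- : m p = g2 p + k2 by apply: min_r; exact: ltW.
by rewrite (mc p q) ge_min lexx orbT.
Qed.

Lemma tconv_extremals E (s : seq (gpoint G -> R)) : Div d E -> [set` s] `<=` eff_Div d ->
  tconv d [set` s] `<=` tconv d (extremals d (tconv d [set` s])).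
Proof.
move=> dE; have [n] := ubnP (size s); elim: n s => // n IH s sn seff.
have [irr|] := pselect (forall D, D \in s -> ~ tconv d ([set` s] `\ D) D).
  by apply: tconv_mono => D Ds; apply: extremal_of_irredundant => //; exact: irr.
move=> /existsNP[D /not_implyP[Ds /contrapT DD]].
pose r := [seq D' <- s | D' != D].
have rE : [set` s] `\ D = [set` r].
  apply/seteqP; split=> D' /=; rewrite mem_filter.
    by case=> -> /eqP ->.
  by case/andP => /eqP ? ->.
rewrite {}rE in DD.
have reff : [set` r] `<=` eff_Div d by move=> D' /=; rewrite mem_filter => /andP[_ /seff].
(* The rewriting also reaches inside [extremals], which depends on the hull and not on its
   generators. *)
have -> : tconv d [set` s] = tconv d [set` r].
  apply/seteqP; split; last first.
    by apply: tconv_mono => D' /=; rewrite mem_filter => /andP[].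
  apply: smallest_sub; first by have [] := tconvE reff dE.
  move=> D' D's; have [-> //|ne] := eqVneq D' D.
  by apply: sub_gen_smallest; rewrite /= mem_filter ne.
apply: IH => //; apply: leq_trans (_ : size r < size s)%N _; last by rewrite -ltnS.
rewrite size_filter -(count_predC (pred1 D) s) -addn1 addnC leq_add2r -has_count.
by apply/hasP; exists D => /=.
Qed.

End TropicalPolytope.

Theorem theorem9p9 (R : realType) (G : metricGraph R) (d : R) (hd : 0 <= d)
    (n : nat) (Ds : 'I_n -> gpoint G -> R) (hDs : forall i, eff_Div d (Ds i))
    (T : set (gpoint G -> R)) (hT : T = tconv d (range Ds))
    (E : gpoint G -> R) (hE : Div d E) :
  (T E <-> \bigcup_i argmin (potential (Ds i - E)) = [set: gpoint G]) /\
  (forall D0 D : gpoint G -> R, D0 = tropical_projection T E -> T D ->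
     argmin (potential (D - E)) `<=` argmin (potential (D0 - E)) /\
     argmin (potential (D0 - E)) = \bigcup_i argmin (potential (Ds i - E))) /\
  (forall S : set (gpoint G -> R), S = extremals d T ->
     S `<=` range Ds /\ T = tconv d S).
Proof.
pose s := [seq Ds i | i <- enum 'I_n].
have sE : range Ds = [set` s].
  apply/seteqP; split=> [_ [i _ <-]|D /mapP[i _ ->]]; last by exists i.
  by apply: map_f; rewrite mem_enum.
have seff : [set` s] `<=` eff_Div d by rewrite -sE => _ [i _ <-].
have argE p : (exists2 D, D \in s & argmin (potential (D - E)) p) <->
    (\bigcup_i argmin (potential (Ds i - E))) p.
  split=> [[_ /mapP[i _ ->] ip]|[i _ ip]]; first by exists i.
  by exists (Ds i) => //; apply: map_f; rewrite mem_enum.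
rewrite sE in hT; subst T; split; [|split].
- rewrite tconv_cover //; split=> [H|H p]; last by apply/argE; rewrite H.
  by apply/seteqP; split=> // p _; apply/argE.
- move=> D0 D -> TD.
  have [TE _] := tconvE seff hE; rewrite TE in TD; case: TD => g sg <-.
  (* A point of [T] comes from at least one generator; this excludes the empty polytope, where the
     projection takes its default value. *)
  have s0 : s != [::].
    have /card_gt0P[v _] := vertex_gt0 G.
    have [f [[_ sf] _ _]] := min_span_touch (Vertex v) sg.
    by case: s sf {sE seff argE TE sg}.
  have [h [ch -> amh gh]] := tropical_projectionE seff hE s0.
  rewrite !argmin_potential ?(min_span_cpa sg) //; last exact: min_span_cpa sg.
  split; first exact: gh.
  by rewrite amh; apply/seteqP; split=> p /argE.
- move=> S ->; split.
    (* If [D] were not a generator, removing it from [T] would leave all generators, whose hull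
       still contains [D]. *)
    move=> D [TD nD]; rewrite sE; apply: contrapT => Ds'; apply: nD.
    apply: tconv_mono TD => D' D's; split; first exact: sub_gen_smallest.
    by move=> DD; apply: Ds'; rewrite -[D]DD.
  apply/seteqP; split; first exact: tconv_extremals hE seff.
  by apply: smallest_sub; [have [] := tconvE seff hE|move=> D []].
Qed.
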